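(* Let $E$ be an arbitrary (countable, not necessarily row-finite) directed graph. Then $\mathrm{Soc}(L_{\mathbb C}(E))\subseteq \mathrm{Soc}(C^*(E))$, where $L_{\mathbb C}(E)$ is identified with a $*$-subalgebra of $C^*(E)$ via the canonical embedding. Moreover, there exists a row-finite graph $E$ such that this inclusion is proper.
   Context: A graph $E=(E^0,E^1,r,s)$ consists of countable sets $E^0$ (vertices), $E^1$ (edges) and maps $r,s:E^1\to E^0$ (range, source). A vertex $v$ is regular if $s^{-1}(v)$ is finite and nonempty; $E$ is row-finite if $s^{-1}(v)$ is finite for every $v$. The Leavitt path algebra $L_{\mathbb C}(E)$ is the $\mathbb C$-algebra generated by a set $\{v: v\in E^0\}$ of pairwise orthogonal idempotents and elements $\{e,e^*: e\in E^1\}$ subject to: (1) $s(e)e=er(e)=e$; (2) $r(e)e^*=e^*s(e)=e^*$; (3) $e^*e'=\delta_{e,e'}r(e)$; (4) $v=\sum_{s(e)=v}ee^*$ for every regular vertex $v$. The graph C*-algebra $C^*(E)$ is the universal C*-algebra generated by mutually orthogonal projections $\{p_v:v\in E^0\}$ and partial isometries $\{s_e:e\in E^1\}$ with mutually orthogonal ranges satisfying $s_e^*s_e=p_{r(e)}$, $s_es_e^*\le p_{s(e)}$ for all $e\in E^1$, and $p_v=\sum_{s(e)=v}s_es_e^*$ for every regular vertex $v$. The canonical embedding $\phi:L_{\mathbb C}(E)\to C^*(E)$ is the (injective) algebra homomorphism with $v\mapsto p_v$, $e\mapsto s_e$, $e^*\mapsto s_e^*$; its image is a dense $*$-subalgebra.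 Both algebras are semiprime; the socle $\mathrm{Soc}(R)$ of a semiprime ring $R$ is the (algebraic) sum of all its minimal left ideals (which equals the sum of all its minimal right ideals), and is $0$ if there are none. *)

(* Defs.v *)
From HB Require Import structures.
From mathcomp Require Import all_boot all_order all_algebra.
From mathcomp Require Import all_classical all_reals all_analysis.
From mathcomp Require Export complex.

Set Implicit Arguments.
Unset Strict Implicit.
Unset Printing Implicit Defensive.

Import Order.TTheory GRing.Theory Num.Theory.
Import numFieldNormedType.Exports.

Local Open Scope classical_set_scope.
Local Open Scope complex_scope.
Local Open Scope ring_scope.

Reserved Notation "x ⋅ y" (at level 40, left associativity).
Reserved Notation "x ^★" (at level 2, format "x ^★").

(* Algebras are not assumed to have a unit (L_C(E) and C*(E) have one only
   if E has finitely many vertices), so the MathComp ring structures do not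
   apply. *)
HB.mixin Record Lmodule_isNonUnitalAlgebra (K : pzRingType) A
    of GRing.Lmodule K A := {
  amul : A -> A -> A;
  amulA : associative amul;
  amulDl : left_distributive amul +%R;
  amulDr : right_distributive amul +%R;
  amulZl : forall (k : K) (x y : A), amul (k *: x) y = k *: amul x y;
  amulZr : forall (k : K) (x y : A), amul x (k *: y) = k *: amul x y
}.

#[short(type="nonUnitalAlgType")]
HB.structure Definition NonUnitalAlgebra (K : pzRingType) :=
  {A of Lmodule_isNonUnitalAlgebra K A & GRing.Lmodule K A}.

Notation "x ⋅ y" := (amul x y) : ring_scope.

(* The norm takes its values in the nonnegative reals of R[i]; on R[i] the
   order x <= y means that y - x is a nonnegative real. *)
HB.mixin Record NonUnitalAlgebra_isCStarAlgebra (R : realType) A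
    of NonUnitalAlgebra R[i] A & CompleteNormedModule R[i] A := {
  astar : A -> A;
  astarK : involutive astar;
  astarD : {morph astar : x y / x + y};
  astarZ : forall (k : R[i]) (x : A), astar (k *: x) = k^* *: astar x;
  astarM : forall x y : A, astar (x ⋅ y) = astar y ⋅ astar x;
  anormM : forall x y : A, `|x ⋅ y| <= `|x| * `|y|;
  cstar_identity : forall x : A, `|astar x ⋅ x| = `|x| ^+ 2
}.

#[short(type="cstarAlgType")]
HB.structure Definition CStarAlgebra (R : realType) :=
  {A of NonUnitalAlgebra_isCStarAlgebra R A & NonUnitalAlgebra R[i] A
      & CompleteNormedModule R[i] A}.

Notation "x ^★" := (astar x) : ring_scope.

Definition algebra_hom (K : pzRingType) (A B : nonUnitalAlgType K)
    (f : A -> B) : Prop :=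
  [/\ {morph f : x y / x + y},
      forall (k : K) (x : A), f (k *: x) = k *: f x
    & {morph f : x y / x ⋅ y}].

Definition star_hom (R : realType) (A B : cstarAlgType R) (f : A -> B) : Prop :=
  algebra_hom f /\ {morph f : x / x^★}.

Definition subalgebra (K : pzRingType) (A : nonUnitalAlgType K)
    (S : set A) : Prop :=
  [/\ S 0,
      forall x y, S x -> S y -> S (x + y),
      forall (k : K) x, S x -> S (k *: x)
    & forall x y, S x -> S y -> S (x ⋅ y)].

Definition closed_star_subalgebra (R : realType) (A : cstarAlgType R)
    (S : set A) : Prop :=
  [/\ subalgebra S, forall x, S x -> S (x^★) & closed S].

(* Ideals are ring ideals: closure under scalars is not required. *)
Definition left_ideal (K : pzRingType) (A : nonUnitalAlgType K)
    (I : set A) : Prop :=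
  [/\ I 0,
      forall x y, I x -> I y -> I (x - y)
    & forall a x, I x -> I (a ⋅ x)].

Definition minimal_left_ideal (K : pzRingType) (A : nonUnitalAlgType K)
    (I : set A) : Prop :=
  [/\ left_ideal I,
      I <> [set 0]
    & forall J : set A, left_ideal J -> J `<=` I -> J = [set 0] \/ J = I].

Definition socle (K : pzRingType) (A : nonUnitalAlgType K) : set A :=
  [set x | exists (n : nat) (y : 'I_n -> A),
     (forall i, exists2 I : set A, minimal_left_ideal I & I (y i)) /\
     x = \sum_(i < n) y i].
Arguments socle {K} A.

Record graph := Graph {
  vertex : countType;
  edge : countType;
  range_of : edge -> vertex;
  source_of : edge -> vertex
}.

Definition emitted (E : graph) (v : vertex E) : set (edge E) :=
  [set e | source_of e = v].

Definition regular_vertex (E : graph) (v : vertex E) : Prop :=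
  finite_set (emitted v) /\ emitted v !=set0.

Definition row_finite (E : graph) : Prop :=
  forall v : vertex E, finite_set (emitted v).

Record leavitt_family (K : pzRingType) (E : graph) (A : nonUnitalAlgType K)
    (p : vertex E -> A) (s t : edge E -> A) : Prop := LeavittFamily {
  leavitt_idem : forall v, p v ⋅ p v = p v;
  leavitt_orth : forall v w, v != w -> p v ⋅ p w = 0;
  leavitt_sourcel : forall e, p (source_of e) ⋅ s e = s e;
  leavitt_ranger : forall e, s e ⋅ p (range_of e) = s e;
  leavitt_rangel : forall e, p (range_of e) ⋅ t e = t e;
  leavitt_sourcer : forall e, t e ⋅ p (source_of e) = t e;
  leavitt_CK1 : forall e f,
    t e ⋅ s f = if e == f then p (range_of e) else 0;
  leavitt_CK2 : forall v, regular_vertex v ->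
    p v = \sum_(e \in emitted v) (s e ⋅ t e)
}.

(* The algebra presented by the generators v, e, e^* and the Leavitt
   relations: it is generated by a Leavitt family, and no further relation
   holds, i.e. every other Leavitt family is the image of that one. *)
Record leavitt_path_algebra (K : pzRingType) (E : graph) := LeavittPathAlgebra {
  lpa_alg :> nonUnitalAlgType K;
  lpa_vertex : vertex E -> lpa_alg;
  lpa_edge : edge E -> lpa_alg;
  lpa_ghost : edge E -> lpa_alg;
  lpa_family : leavitt_family lpa_vertex lpa_edge lpa_ghost;
  lpa_generated : forall S : set lpa_alg, subalgebra S ->
    (forall v, S (lpa_vertex v)) -> (forall e, S (lpa_edge e)) ->
    (forall e, S (lpa_ghost e)) -> S = setT;
  lpa_universal : forall (B : nonUnitalAlgType K)
    (p : vertex E -> B) (s t : edge E -> B), leavitt_family p s t ->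
    exists f : lpa_alg -> B,
      [/\ algebra_hom f, forall v, f (lpa_vertex v) = p v,
          forall e, f (lpa_edge e) = s e & forall e, f (lpa_ghost e) = t e]
}.

Definition projection (R : realType) (A : cstarAlgType R) (p : A) : Prop :=
  p^★ = p /\ p ⋅ p = p.

(* The usual order of projections, p <= q iff p q = p. *)
Definition projection_le (R : realType) (A : cstarAlgType R) (p q : A) : Prop :=
  p ⋅ q = p.

Definition partial_isometry (R : realType) (A : cstarAlgType R) (s : A) : Prop :=
  s ⋅ s^★ ⋅ s = s.

Record cuntz_krieger_family (R : realType) (E : graph) (A : cstarAlgType R)
    (p : vertex E -> A) (s : edge E -> A) : Prop := CuntzKriegerFamily {
  ck_projection : forall v, projection (p v);
  ck_orth : forall v w, v != w -> p v ⋅ p w = 0;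
  ck_partial_isometry : forall e, partial_isometry (s e);
  ck_orth_ranges : forall e f, e != f ->
    (s e ⋅ (s e)^★) ⋅ (s f ⋅ (s f)^★) = 0;
  ck_range : forall e, (s e)^★ ⋅ s e = p (range_of e);
  ck_source : forall e, projection_le (s e ⋅ (s e)^★) (p (source_of e));
  ck_regular : forall v, regular_vertex v ->
    p v = \sum_(e \in emitted v) (s e ⋅ (s e)^★)
}.

Record graph_cstar_algebra (R : realType) (E : graph) := GraphCStarAlgebra {
  gca_alg :> cstarAlgType R;
  gca_proj : vertex E -> gca_alg;
  gca_piso : edge E -> gca_alg;
  gca_family : cuntz_krieger_family gca_proj gca_piso;
  gca_generated : forall S : set gca_alg, closed_star_subalgebra S ->
    (forall v, S (gca_proj v)) -> (forall e, S (gca_piso e)) -> S = setT;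
  gca_universal : forall (B : cstarAlgType R)
    (p : vertex E -> B) (s : edge E -> B), cuntz_krieger_family p s ->
    exists f : gca_alg -> B,
      [/\ star_hom f, forall v, f (gca_proj v) = p v
        & forall e, f (gca_piso e) = s e]
}.

(* These conditions determine phi; its injectivity is a theorem (it is not
   assumed here). *)
Definition canonical_embedding (R : realType) (E : graph)
    (L : leavitt_path_algebra R[i] E) (A : graph_cstar_algebra R E)
    (phi : L -> A) : Prop :=
  [/\ algebra_hom phi,
      forall v, phi (lpa_vertex L v) = gca_proj A v,
      forall e, phi (lpa_edge L e) = gca_piso A e
    & forall e, phi (lpa_ghost L e) = (gca_piso A e)^★].

(* Main.v *)
(* Let I be a minimal left ideal of L_C(E). If I I = 0, then phi kills I:
   phi(x) phi(L) phi(x) = 0 for x in I, hence phi(x) C*(E) phi(x) = 0 by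
   density, and C*(E) is semiprime. Otherwise I = L e with e idempotent and
   e L e a division algebra (Brauer). As L has countable dimension and C is
   uncountable, e L e = C e (Amitsur). By density and since C f is closed, the
   idempotent f = phi(e) satisfies f C*(E) f = C f, so that C*(E) f is a minimal
   left ideal (or 0) containing phi(I).

   For the strict inclusion, E has edges n+1 -> 0 for all n. Then L_C(E) is the
   algebra of finitely supported matrices and C*(E) that of the compact
   operators on l^2; the operator with first column (1, 1/2, 1/4, ...) and all
   other columns 0 has rank one but infinite support. *)
Require Import Defs.
From HB Require Import structures.
From mathcomp Require Import finmap.
From mathcomp Require Import all_boot all_order all_algebra.
From mathcomp Require Import ring lra.
From mathcomp Require Import all_classical all_reals all_analysis.
Set Implicit Arguments.
Unset Strict Implicit.
Unset Printing Implicit Defensive.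
Import Order.TTheory GRing.Theory Num.Theory.
Import numFieldNormedType.Exports.
Local Open Scope classical_set_scope.
Local Open Scope complex_scope.
Local Open Scope ring_scope.

(** * Left ideals and the socle *)

(** Without a unit, x need not lie in [A ⋅ x], and a left ideal need not be closed under scalars;
    idempotents repair both defects.

    In the example the real work lies in the universal property of C*(E): every Cuntz-Krieger family
    in a C*-algebra B must extend continuously to the compact operators. This is done without
    Hilbert spaces or spectral theory. A compact operator is a matrix, its norm is a supremum of
    sesquilinear forms over finitely supported vectors, and its products and its image in B are
    limits along the truncations to n by n corners. The products converge because corner products
    are submultiplicative. The images converge because the matrix units of B define a contraction on
    every corner, which the C*-identity extracts from a crude bound. *)

Section NonUnitalAlgebraTheory.
Variables (K : pzRingType) (A : nonUnitalAlgType K).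
Implicit Types (x y z : A) (k : K).

Lemma amul0l x : 0 ⋅ x = 0.
Proof. by apply: (addIr (0 ⋅ x)); rewrite -amulDl !add0r. Qed.

Lemma amul0r x : x ⋅ 0 = 0.
Proof. by apply: (addIr (x ⋅ 0)); rewrite -amulDr !add0r. Qed.

Lemma amulNl x y : (- x) ⋅ y = - (x ⋅ y).
Proof. by rewrite -scaleN1r amulZl scaleN1r. Qed.

Lemma amulNr x y : x ⋅ (- y) = - (x ⋅ y).
Proof. by rewrite -scaleN1r amulZr scaleN1r. Qed.

Lemma amulBl x y z : (x - y) ⋅ z = x ⋅ z - y ⋅ z.
Proof. by rewrite amulDl amulNl. Qed.

Lemma amulBr x y z : z ⋅ (x - y) = z ⋅ x - z ⋅ y.
Proof. by rewrite amulDr amulNr. Qed.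

Lemma amul_suml (I : Type) (r : seq I) (P : pred I) (F : I -> A) x :
  (\sum_(i <- r | P i) F i) ⋅ x = \sum_(i <- r | P i) F i ⋅ x.
Proof.
by apply: (big_morph (fun y => y ⋅ x)) => [y z|]; rewrite (amulDl, amul0l).
Qed.

Lemma amul_sumr (I : Type) (r : seq I) (P : pred I) (F : I -> A) x :
  x ⋅ (\sum_(i <- r | P i) F i) = \sum_(i <- r | P i) x ⋅ F i.
Proof.
by apply: (big_morph (fun y => x ⋅ y)) => [y z|]; rewrite (amulDr, amul0r).
Qed.

Lemma left_ideal_cyclic x : left_ideal [set a ⋅ x | a in setT].
Proof.
split=> [|_ _ [a _ <-] [b _ <-]|a _ [b _ <-]].
- by exists 0; rewrite ?amul0l.
- by exists (a - b); rewrite ?amulBl.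
- by exists (a ⋅ b); rewrite ?amulA.
Qed.

Lemma socle0 : socle A 0.
Proof.
by exists 0%N, (fun=> 0); split=> [[]//|]; rewrite big_ord0.
Qed.

Lemma socleD x y : socle A x -> socle A y -> socle A (x + y).
Proof.
case=> m [a [Ia ->]] [n [b [Ib ->]]].
exists (m + n)%N, (fun i => match fintype.split i with inl j => a j | inr j => b j end).
split=> [i|]; first by case: (fintype.split i).
rewrite big_split_ord /=; congr (_ + _); apply: eq_bigr => i _.
  by rewrite -/(unsplit (inl i)) unsplitK.
by rewrite -/(unsplit (inr i)) unsplitK.
Qed.

Lemma socle_sum n (y : 'I_n -> A) :
  (forall i, socle A (y i)) -> socle A (\sum_(i < n) y i).
Proof.
move=> sy; apply: (big_ind (socle A)) => //; [exact: socle0|exact: socleD].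
Qed.

Lemma minimal_left_ideal_socle (I : set A) x :
  minimal_left_ideal I -> I x -> socle A x.
Proof.
move=> mI Ix; exists 1%N, (fun=> x); split=> [_|]; first by exists I.
by rewrite big_ord1.
Qed.

Lemma set_neq0P (I : set A) : I 0 -> (I <> [set 0]) <-> exists2 x, I x & x <> 0.
Proof.
move=> I0; split=> [IN0|[x Ix xN0] I_eq0]; last first.
  by move: Ix; rewrite I_eq0.
apply: contrapT => nex; apply: IN0; apply/seteqP; split=> [x Ix|_ ->//].
by apply: contrapT => xN0; apply: nex; exists x.
Qed.

(* Brauer: the second alternative says that I = A e and that e A e is a
   division ring. *)
Lemma minimal_left_idealP (I : set A) : minimal_left_ideal I ->
  (forall x y, I x -> I y -> x ⋅ y = 0) \/
  exists e, [/\ I e, e ⋅ e = e, e <> 0, forall x, I x -> x ⋅ e = x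
    & forall u, I u -> u <> 0 -> exists a, a ⋅ u = e].
Proof.
case=> lI IN0 minI; have [I0 IB IM] := lI.
have [sq0|/existsNP[y /existsNP[x /not_implyP[Iy /not_implyP[Ix yx]]]]] :=
  pselect (forall x y, I x -> I y -> x ⋅ y = 0); [by left|right].
have xN0 : x <> 0 by move=> x0; apply: yx; rewrite x0 amul0r.
(* By minimality: the elements of I annihilated by right multiplication by x form a left ideal that
   misses y. *)
have Ann0 z : I z -> z ⋅ x = 0 -> z = 0.
  move=> Iz zx; have [||J0|JI] := minI [set z | I z /\ z ⋅ x = 0].
  - split=> [|a b [Ia ax] [Ib bx]|a b [Ib bx]].
    + by split=> //; rewrite amul0l.
    + by split; [exact: IB|rewrite amulBl ax bx subrr].
    + by split; [exact: IM|rewrite -amulA bx amul0r].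
  - by move=> a [].
  - by have : [set z | I z /\ z ⋅ x = 0] z by []; rewrite J0.
  - by case: yx; have := Iy; rewrite -JI => -[].
(* [I ⋅ x] is a nonzero left ideal inside I, hence all of I. It therefore contains x, and the left
   factor obtained is the idempotent. *)
have [e Ie ex] : exists2 e, I e & e ⋅ x = x.
  have [||J0|JI] := minI [set a ⋅ x | a in I].
  - split=> [|_ _ [b Ib <-] [c Ic <-]|b _ [c Ic <-]].
    + by exists 0; rewrite ?amul0l.
    + by exists (b - c); [exact: IB|rewrite amulBl].
    + by exists (b ⋅ c); [exact: IM|rewrite amulA].
  - by move=> _ [b Ib <-]; exact: IM.
  - by case: yx; have : [set a ⋅ x | a in I] (y ⋅ x) by [exists y]; rewrite J0.
  - by move: Ix; rewrite -{1}JI => -[e Ie ex]; exists e.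
(* [z ⋅ e - z] lies in I and gives 0 when multiplied by x on the right. *)
have Ire z : I z -> z ⋅ e = z.
  move=> Iz; apply/subr0_eq/Ann0; first by apply: IB => //; exact: IM.
  by rewrite amulBl -amulA ex subrr.
exists e; split=> //; first exact: Ire.
  by move=> e0; apply: xN0; rewrite -ex e0 amul0l.
move=> u Iu uN0.
(* Without a unit [A ⋅ u] might vanish. The elements of I killed by all of A form a left ideal,
   which misses x because [y ⋅ x] is not 0. *)
have [a auN0] : exists a, a ⋅ u <> 0.
  apply: contrapT => /forallNP au0.
  have [||J0|JI] := minI [set z | I z /\ forall a, a ⋅ z = 0].
  - split=> [|b c [Ib b0] [Ic c0]|b c [Ic c0]].
    + by split=> // a; rewrite amul0r.
    + by split; [exact: IB|move=> a; rewrite amulBr b0 c0 subrr].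
    + by split; [exact: IM|move=> a; rewrite amulA c0].
  - by move=> b [].
  - apply: uN0; have : [set z | I z /\ forall a, a ⋅ z = 0] u.
      by split=> // a; apply: contrapT; exact: au0.
    by rewrite J0.
  - by case: yx; have := Ix; rewrite -JI => -[_ ->].
have [||J0|JI] := minI [set a ⋅ u | a in setT]; first exact: left_ideal_cyclic.
- by move=> _ [b _ <-]; exact: IM.
- case: auN0; have : [set a ⋅ u | a in setT] (a ⋅ u) by exists a.
  by rewrite J0.
- by move: Ie; rewrite -{1}JI => -[b _ bu]; exists b.
Qed.

End NonUnitalAlgebraTheory.

Section AlgebraHomTheory.
Variables (K : pzRingType) (A B : nonUnitalAlgType K) (f : A -> B).
Hypothesis homf : algebra_hom f.

Lemma algebra_homD : {morph f : x y / x + y}. Proof. by case: homf. Qed.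

Lemma algebra_homZ k : {morph f : x / k *: x}.
Proof. by case: homf => _ fZ _ x; rewrite fZ. Qed.

Lemma algebra_homM : {morph f : x y / x ⋅ y}. Proof. by case: homf. Qed.

Lemma algebra_hom0 : f 0 = 0.
Proof. by apply: (addIr (f 0)); rewrite -algebra_homD !add0r. Qed.

Lemma algebra_hom_sum (I : Type) (r : seq I) (P : pred I) (F : I -> A) :
  f (\sum_(i <- r | P i) F i) = \sum_(i <- r | P i) f (F i).
Proof. exact: (big_morph f algebra_homD algebra_hom0). Qed.

End AlgebraHomTheory.

(** * Countable spanning sets *)

Section CountablySpanned.
Variables (K : fieldType) (A : nonUnitalAlgType K).

Definition in_span (b : nat -> A) (n : nat) : set A :=
  [set x | exists c : nat -> K, x = \sum_(i < n) c i *: b i].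

Lemma in_span_le (b : nat -> A) m n : (m <= n)%N ->
  in_span b m `<=` in_span b n.
Proof.
move=> lemn _ [c ->]; exists (fun i => if (i < m)%N then c i else 0).
rewrite (big_ord_widen n (fun i => c i *: b i) lemn) big_mkcond /=.
by apply: eq_bigr => i _; case: ifP => // _; rewrite scale0r.
Qed.

Definition lin_span (b : nat -> A) : set A := [set x | exists n, in_span b n x].

Lemma lin_span_subalgebra (b : nat -> A) :
  (forall i j, lin_span b (b i ⋅ b j)) -> subalgebra (lin_span b).
Proof.
move=> bM.
have s0 : lin_span b 0 by exists 0%N, (fun=> 0); rewrite big_ord0.
have sD x y : lin_span b x -> lin_span b y -> lin_span b (x + y).
  case=> m xm [n yn].
  have [c ->] := in_span_le (leq_maxl m n) xm.
  have [d ->] := in_span_le (leq_maxr m n) yn.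
  exists (maxn m n), (fun i => c i + d i); rewrite -big_split /=.
  by apply: eq_bigr => i _; rewrite scalerDl.
have sZ (k : K) x : lin_span b x -> lin_span b (k *: x).
  case=> n [c ->]; exists n, (fun i => k * c i); rewrite scaler_sumr.
  by apply: eq_bigr => i _; rewrite scalerA.
split=> // x y [m [c ->]] [n [d ->]].
rewrite amul_suml; apply: (big_ind (lin_span b)) => // i _.
rewrite amul_sumr; apply: (big_ind (lin_span b)) => // j _.
by rewrite amulZl amulZr; do 2!apply: (sZ); exact: bM.
Qed.

Lemma lin_span_gen (b : nat -> A) i : lin_span b (b i).
Proof.
exists i.+1, (fun j => (j == i)%:R); rewrite big_ord_recr /= eqxx scale1r.
rewrite big1 ?add0r // => j _.
by rewrite (ltn_eqF (ltn_ord j)) scale0r.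
Qed.

(* Words in the generators form a countable spanning set. *)
Lemma countably_spanned (G : countType) (g : G -> A) :
  (forall S : set A, subalgebra S -> (forall i, S (g i)) -> S = setT) ->
  exists b, lin_span b = setT.
Proof.
move=> genA.
(* A first letter and a list encode a nonempty word: there is no unit to stand for the empty one.
   Numbers that code no word are sent to 0. *)
pose w (p : G * seq G) := foldl (fun x i => x ⋅ g i) (g p.1) p.2.
pose b n := if unpickle n is Some p then w p else 0.
have bw p : b (pickle p) = w p by rewrite /b pickleK.
exists b; apply: genA => [|i]; last first.
  by rewrite -[g i]/(w (i, [::])) -bw; exact: lin_span_gen.
apply: lin_span_subalgebra => i j.
have sp0 : lin_span b 0 by exists 0%N, (fun=> 0); rewrite big_ord0.
rewrite [b i]/b; case: (unpickle i) => [[h s]|]; last by rewrite amul0l.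
rewrite [b j]/b; case: (unpickle j) => [[k t]|]; last by rewrite amul0r.
suff -> : w (h, s) ⋅ w (k, t) = w (h, s ++ k :: t).
  by rewrite -bw; exact: lin_span_gen.
rewrite /w /= foldl_cat /=; move: (foldl _ _ s) => x.
elim/last_ind: t => [//|t l IH]; by rewrite !foldl_rcons amulA IH.
Qed.

End CountablySpanned.

(** * Countable-dimensional division algebras *)

(** The rank is at most n. The rows will be the coordinates of n+1 resolvents in a span of n
    elements. *)
Lemma left_kernel_vector (K : fieldType) (n : nat) (m : 'I_n.+1 -> 'I_n -> K) :
  exists2 c : 'I_n.+1 -> K, exists i, c i != 0 &
    forall j, \sum_i c i * m i j = 0.
Proof.
pose M := \matrix_(i, j) m i j.
have /rowV0Pn[v /sub_kermxP vM v0] : kermx M != 0.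
  rewrite -mxrank_eq0 mxrank_ker subn_eq0 -ltnNge.
  exact: leq_ltn_trans (rank_leq_col M) _.
exists (v 0) => [|j].
  apply/existsP; apply: contraNT v0; rewrite negb_exists => /forallP v0.
  by apply/eqP/rowP => i; rewrite mxE; apply/eqP; have := v0 i; rewrite negbK.
by have /rowP/(_ j) := vM; rewrite !mxE; under eq_bigr do rewrite mxE.
Qed.

Section Amitsur.
Variables (K : closedFieldType) (A : nonUnitalAlgType K).
Variables (e u : A).
Hypotheses (ee : e ⋅ e = e) (eu : e ⋅ u = u) (ue : u ⋅ e = u).

(* Evaluation at u in the corner eAe, whose unit is e. *)
Definition corner_horner (p : {poly K}) : A :=
  \sum_(i < size p) p`_i *: iter i (amul u) e.

Lemma corner_horner_wide (p : {poly K}) n : (size p <= n)%N ->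
  corner_horner p = \sum_(i < n) p`_i *: iter i (amul u) e.
Proof.
move=> le_pn; rewrite /corner_horner.
rewrite (big_ord_widen n (fun i => p`_i *: iter i (amul u) e) le_pn).
rewrite big_mkcond /=; apply: eq_bigr => i _; case: ltnP => // le_pi.
by rewrite nth_default ?scale0r.
Qed.

Lemma corner_hornerD (p q : {poly K}) :
  corner_horner (p + q) = corner_horner p + corner_horner q.
Proof.
rewrite (corner_horner_wide (size_polyD p q)).
rewrite (corner_horner_wide (leq_maxl (size p) (size q))).
rewrite (corner_horner_wide (leq_maxr (size p) (size q))) -big_split /=.
by apply: eq_bigr => i _; rewrite coefD scalerDl.
Qed.

Lemma corner_hornerZ k (p : {poly K}) : corner_horner (k *: p) = k *: corner_horner p.
Proof.
rewrite (corner_horner_wide (size_scale_leq k p)) scaler_sumr.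
by apply: eq_bigr => i _; rewrite coefZ scalerA.
Qed.

Lemma corner_horner0 : corner_horner 0 = 0.
Proof. by rewrite /corner_horner size_poly0 big_ord0. Qed.

Lemma corner_horner_sum (I : Type) (r : seq I) (P : pred I) (F : I -> {poly K}) :
  corner_horner (\sum_(i <- r | P i) F i) =
  \sum_(i <- r | P i) corner_horner (F i).
Proof. exact: (big_morph _ corner_hornerD corner_horner0). Qed.

Lemma corner_horner1 : corner_horner 1 = e.
Proof. by rewrite /corner_horner size_poly1 big_ord1 coef1 scale1r. Qed.

Lemma mul_corner_horner (p : {poly K}) : e ⋅ corner_horner p = corner_horner p.
Proof.
rewrite amul_sumr; apply: eq_bigr => i _; rewrite amulZr.
by case: (nat_of_ord i) => [|j] /=; rewrite ?ee ?amulA ?eu.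
Qed.

(** Over an algebraically closed field every polynomial is a scalar times linear factors, so
    evaluation at u can be controlled one such factor at a time. *)
Lemma corner_horner_XsubC k (p : {poly K}) :
  corner_horner (('X - k%:P) * p) = (u - k *: e) ⋅ corner_horner p.
Proof.
rewrite mulrBl -[- _]scaleN1r corner_hornerD corner_hornerZ mul_polyC.
rewrite corner_hornerZ scaleN1r amulBl amulZl mul_corner_horner.
congr (_ - _).
have -> : 'X * p = \poly_(i < (size p).+1) (if i is j.+1 then p`_j else 0).
  apply/polyP => i; rewrite coefXM coef_poly.
  case: i => [|i] /=; first by [].
  by rewrite ltnS; case: ltnP => // /leq_sizeP ->.
rewrite (corner_horner_wide (size_poly _ _)) big_ord_recl coef_poly /= scale0r.
rewrite add0r /corner_horner amul_sumr; apply: eq_bigr => i _.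
by rewrite coef_poly /= ltnS ltn_ord amulZr.
Qed.

(* Amitsur: if u were not scalar, the resolvents (u - k)^-1 would be
   uncountably many linearly independent elements. *)
Lemma countable_division_corner_scalar (b : nat -> A) :
  lin_span b = setT -> ~ countable [set: K] -> e <> 0 ->
  (forall x, e ⋅ x = x -> x ⋅ e = x -> x <> 0 -> exists a, a ⋅ x = e) ->
  exists k, u = k *: e.
Proof.
move=> spanb uncK eN0 div; apply: contrapT => /forallNP uNk.
have linv k : exists w, w ⋅ (u - k *: e) = e.
  apply: div; rewrite ?amulBr ?amulBl ?amulZr ?amulZl ?eu ?ue ?ee //.
  by move/subr0_eq => /uNk.
have /choice[w wu] := linv.
(* Pigeonhole: uncountably many resolvents are distributed over countably many finite-dimensional
   spans. *)
have [n infn] : exists n, infinite_set [set k | in_span b n (w k)].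
  apply: contrapT => /forallNP fin; apply: uncK.
  suff -> : [set: K] = \bigcup_n [set k | in_span b n (w k)].
    by apply: bigcup_countable => // n _; apply: finite_set_countable;
       apply: contrapT; exact: fin.
  apply/esym/seteqP; split=> // k _.
  by have : lin_span b (w k) by [rewrite spanb]; case=> n wn; exists n.
have [X Xw cardX] := infinite_set_fset n.+1 infn.
pose lam (i : 'I_n.+1) := nth 0 (enum_fset X) i.
have lamX i : lam i \in X.
  by apply: mem_nth; rewrite (leq_trans _ cardX).
have lam_inj : injective lam.
  move=> i j /eqP; rewrite nth_uniq ?fset_uniq ?(leq_trans _ cardX) //.
  by move/eqP/val_inj.
have /choice[m wE] (i : 'I_n.+1) :
    exists c : nat -> K, w (lam i) = \sum_(j < n) c j *: b j.
  by have := Xw _ (lamX i).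
have [c [i0 ci0] cm] := left_kernel_vector (fun i (j : 'I_n) => m i j).
have cw : \sum_i c i *: w (lam i) = 0.
  under eq_bigr => i _ do rewrite wE scaler_sumr.
  rewrite exchange_big /= big1 // => j _.
  under eq_bigr do rewrite scalerA.
  by rewrite -scaler_suml cm scale0r.
(* A linear factor can be cancelled by its left inverse [w k]. *)
have ker0 k p : corner_horner (('X - k%:P) * p) = 0 -> corner_horner p = 0.
  rewrite corner_horner_XsubC => /(congr1 (amul (w k))).
  by rewrite amulA wu mul_corner_horner amul0r.
(* Clearing denominators: the resolvent at [lam i] times the full product is the product without its
   i-th factor. The dependence among the resolvents thus becomes a polynomial relation for u. *)
pose Q i := \prod_(j | j != i) ('X - (lam j)%:P).
have QE i : corner_horner (Q i) =
    w (lam i) ⋅ corner_horner (\prod_j ('X - (lam j)%:P)).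
  by rewrite (bigD1 i) //= corner_horner_XsubC amulA wu mul_corner_horner.
pose P := \sum_i c i *: Q i.
have P0 : corner_horner P = 0.
  rewrite corner_horner_sum.
  under eq_bigr => i _ do rewrite corner_hornerZ QE -amulZl.
  by rewrite -amul_suml cw amul0l.
(* As in Lagrange interpolation, at [lam i0] all terms vanish except the one of index i0. *)
have PN0 : P != 0.
  apply/eqP => /(congr1 (fun p => p.[lam i0])) /eqP; apply/negP.
  rewrite horner0 horner_sum (bigD1 i0) //= big1 ?addr0 => [|i ne_i].
    rewrite hornerZ mulf_neq0 // horner_prod; apply/prodf_neq0 => j ne_j.
    by rewrite hornerXsubC subr_eq0 (inj_eq lam_inj) eq_sym.
  rewrite hornerZ horner_prod (bigD1 i0) 1?eq_sym //=.
  by rewrite hornerXsubC subrr mul0r mulr0.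
(* Cancelling the linear factors of P one after the other ends at the empty product, whose value is
   e, so e = 0. *)
have [r PE] := closed_field_poly_normal P.
have : corner_horner (\prod_(z <- r) ('X - z%:P)) = 0.
  move/eqP: P0; rewrite PE corner_hornerZ scaler_eq0 lead_coef_eq0 (negPf PN0).
  by move/eqP.
elim: r {PE} => [|z r IH]; first by rewrite big_nil corner_horner1.
by rewrite big_cons => /ker0.
Qed.
End Amitsur.

(** Otherwise the real unit interval would be countable and have Lebesgue measure 0 instead of 1. *)
Lemma complex_uncountable (R : realType) : ~ countable [set: R[i]].
Proof.
move=> /countable_injP[f injf].
have : countable (`[0%R, 1%R] : set R).
  apply/countable_injP; exists (f \o real_complex R) => x y _ _ /injf.
  by rewrite !inE => /(_ I I) [].
move/countable_lebesgue_measure0; rewrite lebesgue_measure_itv /= lte_fin ltr01.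
by rewrite sube0 => /eqP; rewrite eqe oner_eq0.
Qed.

(** * The image of the socle *)
Section ComplexComplete.
Variable R : realType.

Lemma complex_gt0P (e : R[i]) : 0 < e -> exists2 r : R, 0 < r & e = r%:C.
Proof. by case: e => a b; rewrite ltcE /= => /andP[/eqP-> a0]; exists a. Qed.

Lemma ge_norm_Re (z : R[i]) : `|complex.Re z|%:C <= `|z|.
Proof. exact: normc_ge_Re. Qed.

Lemma norm_i : `|0 +i* 1 : R[i]| = 1.
Proof. by rewrite normc_def /= expr0n expr1n add0r sqrtr1. Qed.

Lemma ge_norm_Im (z : R[i]) : `|complex.Im z|%:C <= `|z|.
Proof.
have := normc_ge_Re (z * (0 +i* 1)); rewrite ReiNIm normrN normrM => /le_trans; apply.
by rewrite norm_i mulr1.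
Qed.

Lemma le_norm_ReIm (z : R[i]) : `|z| <= (`|complex.Re z| + `|complex.Im z|)%:C.
Proof.
rewrite [X in `|X|]complexE (le_trans (ler_normD _ _)) // rmorphD normrM.
rewrite norm_i mul1r.
by rewrite !normc_def /= !expr0n !addr0 !sqrtr_sqr.
Qed.

(** Real and imaginary parts are 1-Lipschitz, so each pushes F to a Cauchy filter on R; the two
    limits are reassembled by [le_norm_ReIm]. *)
Lemma complex_complete (F : set_system R[i]^o) :
  ProperFilter F -> cauchy F -> cvg F.
Proof.
move=> FF /cauchyP cF.
have cp (p : R[i] -> R) : (forall x y, p (x - y) = p x - p y) ->
    (forall z, `|p z|%:C <= `|z|) -> exists a : R, fmap (p : R[i]^o -> R) F --> a.
  move=> pB ple.
  have FpF : ProperFilter (fmap (p : R[i]^o -> R) F) by exact: fmap_proper_filter.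
  apply/cvg_ex; apply: (@R_complete R _ FpF).
  apply/cauchyP => e e0; have := cF e%:C; rewrite ltcR => /(_ e0)[x Fx].
  exists (p x); suff : F (p @^-1` ball (p x) e) by [].
  apply: filterS Fx => y /=; rewrite -!ball_normE /= -pB => xy.
  by rewrite -ltcR; exact: le_lt_trans (ple _) xy.
have ReB (x y : R[i]) : complex.Re (x - y) = complex.Re x - complex.Re y.
  by case: x y => ? ? [].
have ImB (x y : R[i]) : complex.Im (x - y) = complex.Im x - complex.Im y.
  by case: x y => ? ? [].
have [a Fa] := cp (@complex.Re R) ReB ge_norm_Re.
have [b Fb] := cp (@complex.Im R) ImB ge_norm_Im.
apply/cvg_ex; exists (a +i* b); apply/cvgrPdist_lt => e /complex_gt0P[r r0 ->].
have r20 : 0 < r / 2 by rewrite divr_gt0.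
move/cvgrPdist_lt: Fa => /(_ _ r20) Fa.
move/cvgrPdist_lt: Fb => /(_ _ r20) Fb.
near=> z; apply: (le_lt_trans (le_norm_ReIm _)); rewrite ltcR ReB ImB /=.
rewrite (splitr r) ltrD //; near: z; [exact: Fa|exact: Fb].
Unshelve. all: by end_near. Qed.

End ComplexComplete.

(** * C*-algebras: semiprimeness, minimal idempotents, closed lines *)

Section CStarTheory.
Variables (R : realType) (A : cstarAlgType R).
Implicit Types (x y : A).

Lemma astar0 : (0 : A)^★ = 0.
Proof. by apply: (addIr (0^★)); rewrite -astarD !add0r. Qed.

Lemma astarN x : (- x)^★ = - x^★.
Proof. by rewrite -scaleN1r astarZ rmorphN1 scaleN1r. Qed.

Lemma astarB x y : (x - y)^★ = x^★ - y^★.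
Proof. by rewrite astarD astarN. Qed.

(** The C*-identity gives |x|^2 <= |x^★| |x|; dividing by |x| gives one inequality, and the
    involution gives the other. *)
Lemma astar_norm x : `|x^★| = `|x|.
Proof.
suff le_star y : `|y| <= `|y^★|.
  by apply/eqP; rewrite eq_le le_star -{2}(astarK x) le_star.
have [->|y0] := eqVneq y 0; first by rewrite normr0.
have := anormM y^★ y; rewrite cstar_identity expr2 ler_pM2r //.
by rewrite normr_gt0.
Qed.

Lemma cstar_mul0 x : x^★ ⋅ x = 0 -> x = 0.
Proof.
move=> /(congr1 Num.norm); rewrite cstar_identity normr0 => /eqP.
by rewrite sqrf_eq0 normr_eq0 => /eqP.
Qed.

(** Taking a = x^★ shows that the self-adjoint element x^★ x has square 0. The C*-identity then
    kills x^★ x, and after it x. *)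
Lemma cstar_semiprime x : (forall a, x ⋅ a ⋅ x = 0) -> x = 0.
Proof.
move=> xAx; apply/cstar_mul0/cstar_mul0.
by rewrite astarM astarK amulA -(amulA _ x) -amulA xAx amul0r.
Qed.

(** For a nonzero x = x f in J, semiprimeness provides a with f a x nonzero. This element lies in J
    and in f A f, so it is a nonzero multiple of f, and f itself is in J. *)
Lemma minimal_idempotent_left_ideal (f : A) : f ⋅ f = f -> f <> 0 ->
  (forall x, exists c : R[i], f ⋅ x ⋅ f = c *: f) ->
  minimal_left_ideal [set a ⋅ f | a in [set: A]].
Proof.
move=> ff fN0 fAf; split; first exact: left_ideal_cyclic.
  move=> I0; apply: fN0.
  by have : [set a ⋅ f | a in setT] f by [exists f]; rewrite I0.
move=> J lJ JI; have [J0 _ JM] := lJ.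
have [->|/(set_neq0P J0)[x Jx xN0]] := pselect (J = [set 0]); [by left|right].
have xf : x ⋅ f = x by have [a _ <-] := JI _ Jx; rewrite -amulA ff.
have [a faxN0] : exists a, f ⋅ a ⋅ x <> 0.
  apply: contrapT => /forallNP fax0; apply/xN0/cstar_semiprime => a.
  have /contrapT fax := fax0 a.
  by rewrite -{1}xf -!amulA (amulA f) fax amul0r.
have [c fxE] := fAf (a ⋅ x).
rewrite amulA -(amulA _ x) xf in fxE.
have c0 : c != 0 by apply/eqP => c0; apply: faxN0; rewrite fxE c0 scale0r.
(* J need not be closed under scalars, so c^-1 enters through the multiplier [c^-1 *: f]. *)
have Jf : J f.
  have := JM (c^-1 *: f) _ (JM (f ⋅ a) _ Jx).
  by rewrite fxE amulZl amulZr ff scalerA mulVf // scale1r.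
by apply/seteqP; split=> // _ [b _ <-]; exact: JM.
Qed.

Lemma closedP (S : set A) :
  closed S <-> forall x,
    (forall e : R[i], 0 < e -> exists2 y, S y & `|x - y| < e) -> S x.
Proof.
split=> [cS x xS|HS x clx].
  apply: cS => B /nbhs_ballP[e /= e0 xB]; have [y Sy xy] := xS e e0.
  by exists y; split=> //; apply: xB; rewrite -ball_normE.
apply: HS => e e0; have [y [Sy]] := clx _ (nbhsx_ballx x e e0).
by rewrite -ball_normE => xy; exists y.
Qed.

(** The map c to c f multiplies distances by |f|, so for nonzero f the line is as complete as the
    scalars. The case f = 0, where the line is {0}, serves the ideals of square zero. *)
Lemma closed_line (f : A) : closed [set c *: f | c in [set: R[i]]].
Proof.
have [->|f0] := eqVneq f 0.
  apply/closedP => x xS; exists 0; rewrite // scaler0; apply/esym/eqP.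
  rewrite -normr_eq0; apply/eqP/le_anti; rewrite normr_ge0 andbT.
  apply/ler_addgt0Pr => e e0; rewrite add0r.
  by have [_ [c _ <-]] := xS e e0; rewrite scaler0 subr0 => /ltW.
apply/closedP => x xS.
have nf0 : 0 < `|f| by rewrite normr_gt0.
(* F consists of the sets of scalars that contain every c with [c *: f] close enough to x. It is
   Cauchy, and its limit is the coefficient of x. *)
pose F : set_system R[i]^o := [set V | exists2 r : R, 0 < r &
  forall c : R[i], `|x - c *: f| < r%:C -> V c].
have FF : ProperFilter F.
  apply: Build_ProperFilter_ex => [V [e e0 eV]|].
    have := xS e%:C; rewrite ltcR => /(_ e0)[_ [c _ <-] /eV]; by exists c.
  split=> [|U V [d d0 dU] [e e0 eV]|U V UV [d d0 dU]].
  - by exists 1.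
  - exists (Num.min d e); rewrite ?lt_min ?d0 // => c xc; split.
      by apply: dU; rewrite (lt_le_trans xc) // lecR ge_min lexx.
    by apply: eV; rewrite (lt_le_trans xc) // lecR ge_min lexx orbT.
  - by exists d => // c /dU /UV.
have Fball (e : R[i]) : 0 < e -> exists2 r : R, 0 < r &
    forall c d : R[i], `|x - c *: f| < r%:C -> `|x - d *: f| < r%:C ->
    `|c - d| < e.
  move=> e0; have /complex_gt0P[r r0 rE] : 0 < e * `|f| / 2.
    by rewrite divr_gt0 ?mulr_gt0.
  exists r => // c d xc xd; rewrite -(ltr_pM2r nf0) -normrZ scalerBl.
  rewrite -[_ - _](subrKA x) -opprB addrC (le_lt_trans (ler_normB _ _)) //.
  by rewrite (splitr (e * _)) rE ltrD.
have /cvg_ex[c Fc] : cvg F.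
  apply: complex_complete; apply/cauchyP => e e0.
  have [r r0 rP] := Fball e e0.
  have := xS r%:C; rewrite ltcR => /(_ r0)[_ [c _ <-] xc].
  by exists c; exists r => // d xd; rewrite -ball_normE; exact: rP.
exists c => //; apply/eqP; rewrite eq_sym -subr_eq0 -normr_eq0.
apply/eqP/le_anti; rewrite normr_ge0 andbT.
apply/ler_addgt0Pr => e /complex_gt0P[r r0 ->]; rewrite add0r.
have r20 : 0 < r / 2 by rewrite divr_gt0.
have e0 : 0 < (r / 2)%:C / `|f| by rewrite divr_gt0 // ltcR.
have [d [xd cd]] : exists d : R[i],
    `|x - d *: f| < (r / 2)%:C /\ `|c - d| < (r / 2)%:C / `|f|.
  have Fce := Fc _ (nbhsx_ballx (c : R[i]^o) _ e0).
  have Fxd : F [set d | `|x - d *: f| < (r / 2)%:C] by exists (r / 2).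
  by have [d [xd]] := filter_ex (filterI Fxd Fce); rewrite -ball_normE; exists d.
rewrite -(subrKA (d *: f)) -scalerBl (le_trans (ler_normD _ _)) //.
rewrite normrZ (splitr r) rmorphD lerD //; first exact: ltW.
by rewrite -ler_pdivlMr // distrC ltW.
Qed.

End CStarTheory.

(** * Density of the Leavitt path algebra and transfer of minimal left ideals *)

Section GraphCStar.
Variables (R : realType) (E : graph) (L : leavitt_path_algebra R[i] E).
Variables (A : graph_cstar_algebra R E) (phi : L -> A).
Hypothesis cphi : canonical_embedding phi.

Let hphi : algebra_hom phi. Proof. by case: cphi. Qed.

(** L is presented without an involution, so the preimage of an adjoint is found on generators and
    propagated to the subalgebra they generate. *)
Lemma canonical_embedding_star l : exists l', (phi l)^★ = phi l'.
Proof.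
have [_ phiv phie phit] := cphi.
suff /seteqP[_ /(_ l)] : [set l | exists l', (phi l)^★ = phi l'] = setT by exact.
apply: lpa_generated => [|v|e|e].
- split=> [|x y [x' xx'] [y' yy']|k x [x' xx']|x y [x' xx'] [y' yy']].
  + by exists 0; rewrite (algebra_hom0 hphi) astar0.
  + by exists (x' + y'); rewrite !(algebra_homD hphi) astarD xx' yy'.
  + by exists (k^* *: x'); rewrite !(algebra_homZ hphi) astarZ xx'.
  + by exists (y' ⋅ x'); rewrite !(algebra_homM hphi) astarM xx' yy'.
- by exists (lpa_vertex L v); rewrite phiv; case: (ck_projection (gca_family A) v).
- by exists (lpa_ghost L e); rewrite phie phit.
- by exists (lpa_edge L e); rewrite phie phit astarK.
Qed.

(** The closure of the image of phi is a closed star-subalgebra that contains the generators of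
    A. *)
Lemma canonical_embedding_dense (x : A) (eps : R[i]) :
  0 < eps -> exists l, `|x - phi l| < eps.
Proof.
have [_ phiv phie _] := cphi.
suff /seteqP[_ /(_ x I) Sx] : [set x : A | forall e : R[i], 0 < e ->
    exists l, `|x - phi l| < e] = setT by exact: Sx.
have small (e M : R[i]) : 0 < e -> 0 <= M -> exists2 d, 0 < d & d * M < e.
  move=> e0 M0; exists (e / (M + 1)); first by rewrite divr_gt0 // ltr_wpDl.
  by rewrite mulrAC ltr_pdivrMr ?ltr_wpDl // ltr_pM2l // ltrDl.
apply: gca_generated => [|v|f] /=; last 2 first.
- by move=> e e0; exists (lpa_vertex L v); rewrite phiv subrr normr0.
- by move=> e e0; exists (lpa_edge L f); rewrite phie subrr normr0.
split=> [|y Sy e e0|]; first split.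
- by move=> e e0; exists 0; rewrite (algebra_hom0 hphi) subrr normr0.
- move=> y z Sy Sz e e0; have e20 : 0 < e / 2 by rewrite divr_gt0.
  have [l yl] := Sy _ e20; have [m zm] := Sz _ e20; exists (l + m).
  rewrite (algebra_homD hphi) opprD addrACA (le_lt_trans (ler_normD _ _)) //.
  by rewrite (splitr e) ltrD.
- move=> k y Sy e e0; have [d d0 dke] := small e `|k| e0 (normr_ge0 _).
  have [l yl] := Sy d d0; exists (k *: l).
  rewrite (algebra_homZ hphi) -scalerBr normrZ mulrC (le_lt_trans _ dke) //.
  by rewrite ler_wpM2r // ltW.
- move=> y z Sy Sz e e0; have e20 : 0 < e / 2 by rewrite divr_gt0.
  have [d d0 dze] := small _ `|z| e20 (normr_ge0 _).
  have [l yl] := Sy d d0.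
  have [c c0 cle] := small _ `|phi l| e20 (normr_ge0 _).
  have [m zm] := Sz c c0; exists (l ⋅ m).
  rewrite (algebra_homM hphi) -(subrKA (phi l ⋅ z)) -amulBl -amulBr.
  rewrite (le_lt_trans (ler_normD _ _)) // (splitr e) ltrD //.
    rewrite (le_lt_trans (anormM _ _)) // (le_lt_trans _ dze) //.
    by rewrite ler_wpM2r // ltW.
  rewrite (le_lt_trans (anormM _ _)) // mulrC (le_lt_trans _ cle) //.
  by rewrite ler_wpM2r // ltW.
- have [l yl] := Sy e e0; have [l' ll'] := canonical_embedding_star l.
  by exists l'; rewrite -ll' -astarB astar_norm.
- apply/closedP => y yS e e0; have e20 : 0 < e / 2 by rewrite divr_gt0.
  have [z Sz yz] := yS _ e20; have [l zl] := Sz _ e20; exists l.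
  rewrite -(subrKA z) (le_lt_trans (ler_normD _ _)) // (splitr e) ltrD //.
Qed.

(** Compression by phi(e) is Lipschitz with constant |phi(e)|^2, so density carries a closed
    condition from L to A. It serves for idempotents and for elements of square-zero ideals
    alike. *)
Lemma canonical_embedding_corner (S : set A) (e : L) : closed S ->
  (forall l, S (phi (e ⋅ l ⋅ e))) -> forall x, S (phi e ⋅ x ⋅ phi e).
Proof.
move=> /closedP clS Se x; apply: clS => d d0.
have M1 : 0 < `|phi e| ^+ 2 + 1 by rewrite ltr_wpDl // exprn_ge0.
have [l xl] := canonical_embedding_dense x (divr_gt0 d0 M1).
exists (phi (e ⋅ l ⋅ e)); first exact: Se.
rewrite !(algebra_homM hphi) -amulBl -amulBr (le_lt_trans (anormM _ _)) //.
rewrite (@le_lt_trans _ _ (`|phi e| * `|x - phi l| * `|phi e|)) //.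
  by rewrite ler_wpM2r // anormM.
rewrite mulrAC -expr2 mulrC; rewrite ltr_pdivlMr // in xl.
by apply: le_lt_trans xl; rewrite ler_wpM2l // lerDl.
Qed.

Lemma lpa_countably_spanned : exists b : nat -> L, lin_span b = setT.
Proof.
apply: (@countably_spanned _ L (vertex E + (edge E + edge E))%type
  (fun g => match g with inl v => lpa_vertex L v
            | inr (inl e) => lpa_edge L e | inr (inr e) => lpa_ghost L e end)).
move=> S sS Sg; apply: lpa_generated => // [v|e|e].
- exact: (Sg (inl v)).
- exact: (Sg (inr (inl e))).
- exact: (Sg (inr (inr e))).
Qed.

Lemma minimal_left_ideal_image (I : set L) x :
  minimal_left_ideal I -> I x -> socle A (phi x).
Proof.
move=> mI Ix; have [[_ _ IM] _ _] := mI.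
have [sq0|[e [Ie ee eN0 Ire Idiv]]] := minimal_left_idealP mI.
  suff -> : phi x = 0 by exact: socle0.
  apply: cstar_semiprime => a.
  (* {0} is written as the line through 0 so that [closed_line] applies. *)
  have xLx l : [set c *: 0 | c in [set: R[i]]] (phi (x ⋅ l ⋅ x)).
    by exists 0; rewrite // -amulA sq0 ?(algebra_hom0 hphi) ?scaler0 //; exact: IM.
  have [c _ <-] := canonical_embedding_corner (@closed_line _ A 0) xLx a.
  by rewrite scaler0.
have [b spanb] := lpa_countably_spanned.
have eLe l : exists k : R[i], e ⋅ l ⋅ e = k *: e.
  apply: (@countable_division_corner_scalar R[i] L e (e ⋅ l ⋅ e) ee _ _ b spanb
    (@complex_uncountable R) eN0).
  - by rewrite !amulA ee.
  - by rewrite -!amulA ee.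
  - by move=> u _ ue; apply: Idiv; rewrite -ue; exact: IM.
have fAf y : exists c : R[i], phi e ⋅ y ⋅ phi e = c *: phi e.
  have eLe' l : [set c *: phi e | c in [set: R[i]]] (phi (e ⋅ l ⋅ e)).
    by have [k ->] := eLe l; exists k; rewrite ?(algebra_homZ hphi).
  have [c _ <-] := canonical_embedding_corner (@closed_line _ A (phi e)) eLe' y.
  by exists c.
rewrite -(Ire x Ix) (algebra_homM hphi).
have [->|fN0] := pselect (phi e = 0); first by rewrite amul0r; exact: socle0.
apply: (minimal_left_ideal_socle (minimal_idempotent_left_ideal _ fN0 fAf)).
  by rewrite -(algebra_homM hphi) ee.
by exists (phi x).
Qed.

Lemma canonical_embedding_socle : phi @` socle L `<=` socle A.
Proof.
move=> _ [_ [n [y [Iy ->]]] <-]; rewrite (algebra_hom_sum hphi).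
by apply: socle_sum => i; have [I mI] := Iy i; exact: minimal_left_ideal_image.
Qed.

End GraphCStar.

(** * Infinite matrices *)
Section SesquilinearForms.
Variable C : numClosedFieldType.
Implicit Types (a b : nat -> nat -> C^o) (x y v : nat -> C) (r s : C).

(** A vector is any sequence, read only through its first n coordinates; finitely supported vectors
    are thus covered and l^2 is never formed. *)
Definition sqnorm n x : C := \sum_(i < n) `|x i| ^+ 2.

Definition mform n a x y : C :=
  \sum_(i < n) \sum_(j < n) (y i)^* * a i j * x j.

(* The operator norm of a on l^2 is at most r. *)
Definition mbound a r : Prop := forall n x y,
  sqnorm n x <= 1 -> sqnorm n y <= 1 -> `|mform n a x y| <= r.

Definition vtrunc n x i : C := if (i < n)%N then x i else 0.

Definition mtrunc n a : nat -> nat -> C^o :=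
  fun i j => if (i < n)%N && (j < n)%N then a i j else 0.

Definition madj a : nat -> nat -> C^o := fun i j => (a j i)^*.

Definition mvec n a x i : C := \sum_(j < n) a i j * x j.

(** Product of the n by n corners, extended by 0: the entries of the full product would be infinite
    sums. *)
Definition mmul n a b : nat -> nat -> C^o :=
  mtrunc n (fun i j => \sum_(k < n) a i k * b k j).

Lemma sqnorm_ge0 n x : 0 <= sqnorm n x.
Proof. by apply: sumr_ge0 => i _; rewrite exprn_ge0. Qed.

Lemma sum_widen (V : nmodType) n k (F : nat -> V) : (n <= k)%N ->
  (forall i, (n <= i)%N -> F i = 0) -> \sum_(i < k) F i = \sum_(i < n) F i.
Proof.
move=> nk F0; rewrite (big_ord_widen k F nk) [RHS]big_mkcond /=.
by apply: eq_bigr => i _; case: ltnP => // /F0.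
Qed.

Lemma sqnorm_le k n x : (k <= n)%N -> sqnorm k x <= sqnorm n x.
Proof.
move=> kn; rewrite /sqnorm (big_ord_widen n (fun i => `|x i| ^+ 2) kn) big_mkcond.
by apply: ler_sum => i _; case: ifP => // _; rewrite exprn_ge0.
Qed.

Lemma sqnorm_vtrunc k n x : sqnorm k (vtrunc n x) <= sqnorm n x.
Proof.
rewrite (le_trans (sqnorm_le _ (leq_maxr n k))) //.
rewrite /sqnorm (@sum_widen _ n _ (fun i => `|vtrunc n x i| ^+ 2)) ?leq_maxl //.
  by apply: ler_sum => i _; rewrite /vtrunc ltn_ord.
by move=> i; rewrite /vtrunc ltnNge => -> /=; rewrite normr0 expr0n.
Qed.

Lemma mform_widen n k a x y : (n <= k)%N ->
  mform k a (vtrunc n x) (vtrunc n y) = mform n a x y.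
Proof.
move=> nk; rewrite /mform (@sum_widen _ n k
  (fun i => \sum_(j < k) (vtrunc n y i)^* * a i j * vtrunc n x j)) //; last first.
  move=> i; rewrite /vtrunc ltnNge => -> /=; rewrite big1 // => j _.
  by rewrite conjC0 !mul0r.
apply: eq_bigr => i _; rewrite (@sum_widen _ n k
  (fun j => (vtrunc n y i)^* * a i j * vtrunc n x j)) //.
  by apply: eq_bigr => j _; rewrite /vtrunc !ltn_ord.
by move=> j; rewrite /vtrunc [(j < n)%N]ltnNge => -> /=; rewrite mulr0.
Qed.

Lemma mform_mtrunc_vtrunc k n a x y :
  mform k (mtrunc n a) x y = mform k a (vtrunc n x) (vtrunc n y).
Proof.
apply: eq_bigr => i _; apply: eq_bigr => j _; rewrite /mtrunc /vtrunc.
by case: (i < n)%N; case: (j < n)%N; rewrite ?conjC0 ?mulr0 ?mul0r.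
Qed.

(** Both sides involve only indices below k and n. Truncation thus moves from the matrix to the
    vectors, whose norms it cannot increase. *)
Lemma mform_mtrunc k n a x y :
  mform k (mtrunc n a) x y = mform n a (vtrunc k x) (vtrunc k y).
Proof.
rewrite -(mform_widen (mtrunc n a) x y (leq_maxl k n)).
rewrite mform_mtrunc_vtrunc; exact: mform_widen (leq_maxr k n).
Qed.

Lemma mformD n a b x y : mform n (a + b) x y = mform n a x y + mform n b x y.
Proof.
rewrite /mform -big_split; apply: eq_bigr => i _.
by rewrite -big_split; apply: eq_bigr => j _; rewrite /= mulrDr mulrDl.
Qed.

Lemma mformZ n c a x y : mform n (c *: a) x y = c * mform n a x y.
Proof.
rewrite /mform mulr_sumr; apply: eq_bigr => i _.
rewrite mulr_sumr; apply: eq_bigr => j _.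
by rewrite -[(c *: a) i j]/(c * a i j) mulrCA -!mulrA.
Qed.

Lemma mform0 n x y : mform n 0 x y = 0.
Proof.
by rewrite /mform big1 // => i _; rewrite big1 // => j _; rewrite mulr0 mul0r.
Qed.

Lemma mformZl n a x y c : mform n a (fun i => c * x i) y = c * mform n a x y.
Proof.
rewrite /mform mulr_sumr; apply: eq_bigr => i _.
by rewrite mulr_sumr; apply: eq_bigr => j _; rewrite mulrCA.
Qed.

Lemma sqnormZ n c x : sqnorm n (fun i => c * x i) = `|c| ^+ 2 * sqnorm n x.
Proof.
by rewrite /sqnorm mulr_sumr; apply: eq_bigr => i _; rewrite normrM exprMn.
Qed.

Lemma mform_adj n a x y : mform n (madj a) x y = (mform n a y x)^*.
Proof.
rewrite /mform rmorph_sum exchange_big /=; apply: eq_bigr => j _.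
rewrite rmorph_sum; apply: eq_bigr => i _ /=.
by rewrite !rmorphM /= conjCK /madj -mulrA mulrC [_ * x j]mulrC.
Qed.

Lemma mbound_ge0 a r : mbound a r -> 0 <= r.
Proof.
move=> /(_ 0%N (fun=> 0) (fun=> 0)); rewrite /sqnorm /mform !big_ord0 normr0.
by apply; rewrite ler01.
Qed.

Lemma mbound0 : mbound 0 0.
Proof. by move=> n x y _ _; rewrite mform0 normr0. Qed.

Lemma mbound_le a r s : r <= s -> mbound a r -> mbound a s.
Proof. by move=> rs ar n x y x1 y1; apply: le_trans rs; exact: ar. Qed.

Lemma mboundD a b r s : mbound a r -> mbound b s -> mbound (a + b) (r + s).
Proof.
move=> ar bs n x y x1 y1; rewrite mformD (le_trans (ler_normD _ _)) //.
by rewrite lerD ?ar ?bs.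
Qed.

Lemma mboundZ c a r : mbound a r -> mbound (c *: a) (`|c| * r).
Proof. by move=> ar n x y x1 y1; rewrite mformZ normrM ler_wpM2l ?ar. Qed.

Lemma mboundN a r : mbound a r -> mbound (- a) r.
Proof. by move=> /(mboundZ (-1)); rewrite scaleN1r normrN1 mul1r. Qed.

Lemma mbound_trunc n a r : mbound a r -> mbound (mtrunc n a) r.
Proof.
move=> ar k x y x1 y1; rewrite mform_mtrunc; apply: ar.
  exact: le_trans (sqnorm_vtrunc _ _ _) x1.
exact: le_trans (sqnorm_vtrunc _ _ _) y1.
Qed.

Lemma mbound_adj a r : mbound a r -> mbound (madj a) r.
Proof. by move=> ar n x y x1 y1; rewrite mform_adj norm_conjC; exact: ar. Qed.

(** An entry is the value of the form at two standard basis vectors. *)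
Lemma mbound_entry a r i j : mbound a r -> `|a i j| <= r.
Proof.
move=> ar; set n := (maxn i j).+1.
have hi : (i < n)%N by rewrite ltnS leq_maxl.
have hj : (j < n)%N by rewrite ltnS leq_maxr.
pose d k : nat -> C := fun l => (l == k)%:R.
have dsum k (F : nat -> C) (hk : (k < n)%N) : \sum_(l < n) F l * d k l = F k.
  rewrite (bigD1 (Ordinal hk)) //= /d eqxx mulr1 big1 ?addr0 // => l.
  by rewrite -val_eqE /= => /negPf ->; rewrite mulr0.
have d1 k : (k < n)%N -> sqnorm n (d k) <= 1.
  move=> hk; rewrite /sqnorm -[leRHS](dsum k (fun=> 1) hk).
  apply: ler_sum => l _; rewrite mul1r /d.
  by case: (_ == _); rewrite ?normr1 ?expr1n // normr0 expr0n.
suff <- : mform n a (d j) (d i) = a i j by apply: ar; exact: d1.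
rewrite /mform -[RHS](dsum i (fun i => a i j) hi); apply: eq_bigr => k _.
rewrite (dsum j (fun l => (d i k)^* * a k l) hj) mulrC; congr (_ * _).
by rewrite /d; case: (_ == _); rewrite ?conjC1 ?conjC0.
Qed.

Lemma le1_norm_sqnorm n x (i : 'I_n) : sqnorm n x <= 1 -> `|x i| <= 1.
Proof.
move=> x1; rewrite -(@expr_le1 _ 2) //; apply: le_trans x1.
by rewrite /sqnorm (bigD1 i) //= lerDl; apply: sumr_ge0 => j _; rewrite exprn_ge0.
Qed.

(** Coordinates of vectors in the unit ball have modulus at most 1, so the sum of the moduli of the
    entries dominates the operator norm. *)
Lemma mbound_sum a r : (forall n, \sum_(i < n) \sum_(j < n) `|a i j| <= r) ->
  mbound a r.
Proof.
move=> ar n x y x1 y1; apply: le_trans (ar n).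
rewrite (le_trans (ler_norm_sum _ _ _)) //; apply: ler_sum => i _.
rewrite (le_trans (ler_norm_sum _ _ _)) //; apply: ler_sum => j _.
rewrite !normrM norm_conjC -[leRHS]mulr1 ler_pM ?mulr_ge0 //.
  exact: ler_piMl (normr_ge0 _) (le1_norm_sqnorm i y1).
exact: le1_norm_sqnorm x1.
Qed.

Lemma mbound_mtrunc_sum n a :
  mbound (mtrunc n a) (\sum_(i < n) \sum_(j < n) `|a i j|).
Proof.
apply: mbound_sum => k; set N := maxn k n.
have trunc0 i j : ~~ ((i < n)%N && (j < n)%N) -> `|mtrunc n a i j| = 0.
  by rewrite /mtrunc => /negPf ->; rewrite normr0.
have -> : \sum_(i < n) \sum_(j < n) `|a i j| =
    \sum_(i < N) \sum_(j < N) `|mtrunc n a i j|.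
  rewrite (@sum_widen _ n N (fun i => \sum_(j < N) `|mtrunc n a i j|)) ?leq_maxr //.
    apply: eq_bigr => i _.
    rewrite (@sum_widen _ n N (fun j => `|mtrunc n a i j|)) ?leq_maxr //.
      by apply: eq_bigr => j _; rewrite /mtrunc !ltn_ord.
    by move=> j nj; rewrite trunc0 // [(j < n)%N]ltnNge nj andbF.
  by move=> i ni; rewrite big1 // => j _; rewrite trunc0 // ltnNge ni.
rewrite (big_ord_widen N (fun i => \sum_(j < k) `|mtrunc n a i j|) (leq_maxl k n)).
rewrite big_mkcond /=; apply: ler_sum => i _; case: ifP => _; last exact: sumr_ge0.
rewrite (big_ord_widen N (fun j => `|mtrunc n a i j|) (leq_maxl k n)).
by rewrite big_mkcond /=; apply: ler_sum => j _; case: ifP.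
Qed.

Lemma mform_le a r n x y p : mbound a r -> 0 <= p ->
  sqnorm n x <= p ^+ 2 -> sqnorm n y <= 1 -> `|mform n a x y| <= r * p.
Proof.
move=> ar p0 xp y1; have [pE|pN0] := eqVneq p 0.
  have x0 (i : 'I_n) : x i = 0.
    apply/eqP; rewrite -normr_eq0 -sqrf_eq0 eq_le exprn_ge0 // andbT.
    move: xp; rewrite pE expr0n; apply: le_trans.
    by rewrite /sqnorm (bigD1 i) //= lerDl; apply: sumr_ge0 => j _; rewrite exprn_ge0.
  rewrite pE mulr0 /mform big1 ?normr0 // => i _.
  by rewrite big1 // => j _; rewrite x0 mulr0.
have pgt0 : 0 < p by rewrite lt_def pN0.
have -> : x = (fun i => p * (p^-1 * x i)) by apply/funext => i; rewrite mulVKf.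
rewrite mformZl normrM (ger0_norm p0) mulrC ler_wpM2r //; apply: ar => //.
rewrite sqnormZ normrV ?unitfE // (ger0_norm p0) exprVn mulrC.
by rewrite ler_pdivrMr ?exprn_gt0 // mul1r.
Qed.

Lemma mform_mvec n a x y : mform n a x y = \sum_(i < n) (y i)^* * mvec n a x i.
Proof.
apply: eq_bigr => i _; rewrite /mvec mulr_sumr.
by apply: eq_bigr => j _; rewrite mulrA.
Qed.

(** Pairing a x with the unit vector in its own direction returns its norm. *)
Lemma sqnorm_mvec a r n x : mbound a r -> sqnorm n x <= 1 ->
  sqnorm n (mvec n a x) <= r ^+ 2.
Proof.
move=> ar x1; set v := mvec n a x; set s := sqnorm n v.
have r0 := mbound_ge0 ar; have s0 : 0 <= s by exact: sqnorm_ge0.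
have [sE|sN0] := eqVneq s 0; first by rewrite sE exprn_ge0.
have q0 : sqrtC s != 0 by rewrite sqrtC_eq0.
have q_ge0 : 0 <= sqrtC s by rewrite sqrtC_ge0.
pose y i := (sqrtC s)^-1 * v i.
have y1 : sqnorm n y <= 1.
  by rewrite sqnormZ normfV (ger0_norm q_ge0) exprVn sqrtCK mulVf.
have := ar n x y x1 y1; rewrite mform_mvec.
have -> : \sum_(i < n) (y i)^* * v i = sqrtC s.
  transitivity ((sqrtC s)^-1 * s); last first.
    by rewrite -{2}(sqrtCK s) expr2 mulKf.
  rewrite /s /sqnorm mulr_sumr; apply: eq_bigr => i _.
  rewrite /y rmorphM /= fmorphV /= (geC0_conj q_ge0) normCK -mulrA.
  by congr (_ * _); rewrite mulrC.
rewrite (ger0_norm q_ge0) => sr.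
by rewrite -(sqrtCK s) ler_pXn2r.
Qed.

Lemma mform_mmul k n a b x y : mform k (mmul n a b) x y =
  mform n a (mvec n b (vtrunc k x)) (vtrunc k y).
Proof.
rewrite /mmul mform_mtrunc /mform; apply: eq_bigr => i _.
transitivity (\sum_(j < n) \sum_(l < n)
    (vtrunc k y i)^* * a i l * (b l j * vtrunc k x j)).
  apply: eq_bigr => j _; rewrite mulr_sumr mulr_suml; apply: eq_bigr => l _.
  by rewrite !mulrA.
by rewrite exchange_big /=; apply: eq_bigr => l _; rewrite /mvec mulr_sumr.
Qed.

Lemma mbound_mmul n a b r s : mbound a r -> mbound b s -> mbound (mmul n a b) (r * s).
Proof.
move=> ar bs k x y x1 y1; rewrite mform_mmul.
apply: mform_le => //; first exact: mbound_ge0 bs.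
  by apply: sqnorm_mvec => //; exact: le_trans (sqnorm_vtrunc _ _ _) x1.
exact: le_trans (sqnorm_vtrunc _ _ _) y1.
Qed.

(* ||a x||^2 = <a^* a x, x>. *)
Lemma mbound_cstar n a r : mbound (mmul n (madj a) a) r ->
  mbound (mtrunc n a) (sqrtC r).
Proof.
move=> ar k x y x1 y1; have r0 := mbound_ge0 ar.
set x' := vtrunc k x; set y' := vtrunc k y.
have x'1 : sqnorm n x' <= 1 by exact: le_trans (sqnorm_vtrunc _ _ _) x1.
have y'1 : sqnorm n y' <= 1 by exact: le_trans (sqnorm_vtrunc _ _ _) y1.
(* Cauchy-Schwarz is phrased as the bound 1 of the identity matrix, so that [mform_le] applies to
   it. The bound comes from 2|w_i||u_i| <= |w_i|^2 + |u_i|^2. *)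
pose id2 : nat -> nat -> C^o := fun i j => (i == j)%:R.
have idform (m : nat) (u w : nat -> C) : mform m id2 u w = \sum_(i < m) (w i)^* * u i.
  rewrite mform_mvec; apply: eq_bigr => i _; congr (_ * _); rewrite /mvec.
  rewrite (bigD1 i) //= /id2 eqxx mul1r big1 ?addr0 // => j.
  by rewrite eq_sym -val_eqE => /negPf ->; rewrite mul0r.
have id1 : mbound id2 1.
  move=> m u w u1 w1; rewrite idform (le_trans (ler_norm_sum _ _ _)) //.
  rewrite -[leRHS]mulr1 -[X in _ <= _ * X](mulfV (_ : 2%:R != 0 :> C)) ?pnatr_eq0 //.
  rewrite mul1r ler_pdivlMr // mulr_suml.
  rewrite (@le_trans _ _ (\sum_(i < m) (`|w i| ^+ 2 + `|u i| ^+ 2))) //.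
    apply: ler_sum => i _; rewrite normrM norm_conjC -subr_ge0.
    by rewrite mulr_natr addrAC -sqrrB real_exprn_even_ge0 // realB ?normr_real.
  by rewrite big_split /= (_ : 2%:R = 1 + 1) // lerD.
rewrite mform_mtrunc -/x' -/y' mform_mvec -idform -[leRHS]mul1r.
apply: mform_le => //; first by rewrite sqrtC_ge0.
rewrite sqrtCK.
have E : sqnorm n (mvec n a x') = mform k (mmul n (madj a) a) x x.
  rewrite mform_mmul -/x' mform_adj mform_mvec rmorph_sum.
  by apply: eq_bigr => i _; rewrite normCK rmorphM /= conjCK.
by rewrite -(ger0_norm (sqnorm_ge0 _ _)) E; exact: ar.
Qed.

End SesquilinearForms.

(** * The C*-algebra of compact matrices *)
Section MatrixTruncation.
Variable C : numClosedFieldType.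
Implicit Types a b : nat -> nat -> C^o.

Lemma mtruncD n a b : mtrunc n (a + b) = mtrunc n a + mtrunc n b.
Proof.
apply/funext => i; apply/funext => j; rewrite /mtrunc.
rewrite -[RHS]/((if _ then _ else _) + (if _ then _ else _)).
by case: ifP; rewrite ?addr0.
Qed.

Lemma mtruncZ n (c : C) a : mtrunc n (c *: a) = c *: mtrunc n a.
Proof.
apply/funext => i; apply/funext => j; rewrite /mtrunc.
by rewrite -[RHS]/(c *: (if _ then _ else _)); case: ifP; rewrite ?scaler0.
Qed.

Lemma mtruncB n a b : mtrunc n (a - b) = mtrunc n a - mtrunc n b.
Proof. by rewrite -[- b]scaleN1r mtruncD mtruncZ scaleN1r. Qed.

Lemma mtrunc_id m n a : (m <= n)%N -> mtrunc n (mtrunc m a) = mtrunc m a.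
Proof.
move=> mn; apply/funext => i; apply/funext => j; rewrite /mtrunc.
case: (ltnP i m) => im; last by rewrite if_same.
case: (ltnP j m) => jm; last by rewrite if_same.
by rewrite (leq_trans im mn) (leq_trans jm mn).
Qed.

Lemma mtrunc_adj n a : mtrunc n (madj a) = madj (mtrunc n a).
Proof.
apply/funext => i; apply/funext => j; rewrite /mtrunc /madj andbC.
by case: ifP; rewrite ?conjC0.
Qed.

Lemma mform_mtrunc_id n a x y : mform n (mtrunc n a) x y = mform n a x y.
Proof. by rewrite mform_mtrunc mform_widen. Qed.

End MatrixTruncation.

Section CompactMatrices.
Variable R : realType.
Implicit Types a b : nat -> nat -> R[i]^o.

(** Moduli are elements of R[i]; taking real parts moves them to R, where suprema exist. *)
Definition mnorm_set a : set R := [set t | exists n x y,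
  [/\ sqnorm n x <= 1, sqnorm n y <= 1 & t = complex.Re `|mform n a x y|]].

Definition mnorm a : R := sup (mnorm_set a).

Lemma norm_Re (z : R[i]) : (complex.Re `|z|)%:C = `|z|.
Proof. by rewrite RRe_real ?normr_real. Qed.

Lemma mnorm_set_neq0 a : mnorm_set a !=set0.
Proof.
exists (complex.Re `|mform 0 a (fun=> 0) (fun=> 0)|), 0%N, (fun=> 0), (fun=> 0).
by rewrite /sqnorm !big_ord0.
Qed.

Lemma mnorm_le a (r : R) : mbound a r%:C -> mnorm a <= r.
Proof.
move=> ar; apply: ge_sup; first exact: mnorm_set_neq0.
by move=> _ [n [x [y [x1 y1 ->]]]]; rewrite -lecR norm_Re; exact: ar.
Qed.

(** Some bound r must be known, since [sup] of an unbounded set is a default value. *)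
Lemma mbound_mnorm a (r : R[i]) : mbound a r -> mbound a (mnorm a)%:C.
Proof.
move=> ar n x y x1 y1; rewrite -norm_Re lecR; apply: ub_le_sup; last by exists n, x, y.
exists (complex.Re r) => _ [m [u [v [u1 v1 ->]]]]; rewrite -lecR norm_Re.
by rewrite RRe_real ?ger0_real ?(mbound_ge0 ar) // ar.
Qed.

(* Norm limits of finitely supported matrices, i.e. compact operators on l^2. *)
Definition mcompact a : Prop := forall e : R[i], 0 < e ->
  exists m, forall n, (m <= n)%N -> mbound (a - mtrunc n a) e.

Definition compact_matrix : {pred nat -> nat -> R[i]^o} := fun a => `[< mcompact a >].

Lemma compact_matrixP a : reflect (mcompact a) (a \in compact_matrix).
Proof. exact: asboolP. Qed.

Lemma mcompact_mtrunc n a : mcompact (mtrunc n a).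
Proof.
move=> e e0; exists n => k nk; rewrite mtrunc_id // subrr.
by apply: mbound_le (@mbound0 _); exact: ltW.
Qed.

Lemma compact_matrix_submod_closed : submod_closed compact_matrix.
Proof.
split; first by apply/compact_matrixP => e /ltW e0; exists 0%N => n _;
  rewrite (_ : mtrunc n 0 = 0) ?subrr; [exact: mbound_le (@mbound0 _)|
  apply/funext => i; apply/funext => j; rewrite /mtrunc if_same].
move=> c a b /compact_matrixP ca /compact_matrixP cb; apply/compact_matrixP => e e0.
(* Half of e is left for each summand; the added 1 allows c = 0. *)
have c1 : 0 < 2 * (`|c| + 1) by rewrite mulr_gt0 // ltr_wpDl.
have [m mP] := ca _ (divr_gt0 e0 c1).
have e20 : 0 < e / 2 by rewrite divr_gt0.
have [k kP] := cb _ e20.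
exists (maxn m k) => n; rewrite geq_max => /andP[/mP na /kP nb].
rewrite mtruncD mtruncZ opprD addrACA -scalerBr (splitr e).
apply: mboundD nb; apply: mbound_le (mboundZ _ na).
rewrite invfM [e * _]mulrA mulrCA; apply: ler_piMr; first exact: ltW.
by rewrite ler_pdivrMr ?ltr_wpDl // mul1r lerDl.
Qed.

HB.instance Definition _ :=
  GRing.isSubmodClosed.Build _ _ compact_matrix compact_matrix_submod_closed.

Record cmat := CMat { cmat_val :> nat -> nat -> R[i]^o;
  cmat_compact : cmat_val \in compact_matrix }.

HB.instance Definition _ := [isSub for cmat_val].
HB.instance Definition _ := [Choice of cmat by <:].
HB.instance Definition _ := [SubChoice_isSubLmodule of cmat by <:].

Implicit Types x y : cmat.

Lemma cmat_valD x y : cmat_val (x + y) = cmat_val x + cmat_val y.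
Proof. by []. Qed.

Lemma cmat_valZ (c : R[i]) x : cmat_val (c *: x) = c *: cmat_val x.
Proof. by []. Qed.

Lemma cmat_bounded x : exists r, mbound x r.
Proof.
have /compact_matrixP/(_ 1 ltr01)[m /(_ _ (leqnn m)) xm] := cmat_compact x.
exists (1 + (\sum_(i < m) \sum_(j < m) `|x i j|)).
rewrite -[X in mbound X _](subrK (mtrunc m x)).
exact: mboundD xm (mbound_mtrunc_sum _ _).
Qed.

Definition cmat_norm x : R[i] := (mnorm x)%:C.

Lemma mbound_cmat_norm x : mbound x (cmat_norm x).
Proof. by have [r] := cmat_bounded x; exact: mbound_mnorm. Qed.

Lemma cmat_norm_le x (r : R[i]) : mbound x r -> cmat_norm x <= r.
Proof.
move=> xr; have r0 := mbound_ge0 xr.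
have rE : (complex.Re r)%:C = r by rewrite RRe_real ?ger0_real.
by rewrite -rE lecR; apply: mnorm_le; rewrite rE.
Qed.

Lemma cmat_normD x y : cmat_norm (x + y) <= cmat_norm x + cmat_norm y.
Proof. by apply: cmat_norm_le; apply: mboundD; exact: mbound_cmat_norm. Qed.

Lemma cmat_normZ (c : R[i]) x : cmat_norm (c *: x) = `|c| * cmat_norm x.
Proof.
have le_normZ d y : cmat_norm (d *: y) <= `|d| * cmat_norm y.
  apply: cmat_norm_le; rewrite cmat_valZ.
  by apply: mboundZ; exact: mbound_cmat_norm.
apply/eqP; rewrite eq_le le_normZ /=.
have [->|c0] := eqVneq c 0.
  by rewrite normr0 mul0r; exact: mbound_ge0 (mbound_cmat_norm _).
rewrite -ler_pdivlMl ?normr_gt0 // -normfV.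
by rewrite -{1}(scalerK c0 x) le_normZ.
Qed.

Lemma cmat_norm0_eq0 x : cmat_norm x = 0 -> x = 0.
Proof.
move=> x0; apply/val_inj/funext => i; apply/funext => j /=.
apply/eqP; rewrite -normr_eq0 eq_le normr_ge0 andbT -x0.
exact: mbound_entry (mbound_cmat_norm _).
Qed.

HB.instance Definition _ :=
  Lmodule_isNormed.Build R[i] cmat cmat_normD cmat_normZ cmat_norm0_eq0.

Lemma mbound_norm x : mbound x `|x|.
Proof. exact: mbound_cmat_norm. Qed.

Lemma cmat_norm_leP x (r : R[i]) : mbound x r <-> `|x| <= r.
Proof.
split; first exact: cmat_norm_le.
by move=> xr; apply: mbound_le (mbound_norm x).
Qed.

Lemma cmat_entry x i j : `|x i j| <= `|x|.
Proof. exact: mbound_entry (mbound_norm x). Qed.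

(** Entries are 1-Lipschitz, so they converge to some matrix l. Each form involves finitely many
    entries, so norm bounds survive this entrywise limit, which makes l compact and the convergence
    uniform. *)
Lemma cmat_complete (F : set_system cmat) : ProperFilter F -> cauchy F -> cvg F.
Proof.
move=> FF /cauchyP cF.
have [l lF] : exists l : nat -> nat -> R[i]^o, forall i j (e : R[i]), 0 < e ->
    F [set x | `|x i j - l i j| < e].
  suff /choice[l lP] : forall i, exists l : nat -> R[i]^o,
      forall j (e : R[i]), 0 < e -> F [set x : cmat | `|x i j - l j| < e].
    by exists l => i; exact: lP.
  move=> i; suff /choice[l lP] : forall j, exists l : R[i]^o,
      forall e : R[i], 0 < e -> F [set x : cmat | `|x i j - l| < e].
    by exists l.
  move=> j.
  have FpF : ProperFilter (fmap (fun x : cmat => x i j) F) by exact: fmap_proper_filter.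
  have /cvg_ex[l Fl] : cvg (fmap (fun x : cmat => x i j) F).
    apply: (@complex_complete R _ FpF); apply/cauchyP => e e0.
    have [x Fx] := cF e e0; exists (x i j).
    suff : F ((fun x : cmat => x i j) @^-1` ball (x i j) e) by [].
    apply: filterS Fx => y; rewrite /= -!ball_normE /= => xy.
    by apply: le_lt_trans xy; exact: (cmat_entry (x - y)).
  exists l => e e0; have Fle : F ((fun x : cmat => x i j) @^-1` ball l e).
    exact: Fl _ (nbhsx_ballx l e e0).
  by apply: filterS Fle => x; rewrite /= -ball_normE /= distrC.
have near_l (x : cmat) (e : R[i]) :
    F (ball x e) -> mbound ((x : nat -> nat -> R[i]^o) - l) e.
  move=> Fx n u v u1 v1; apply/ler_addgt0Pr => d d0.
  (* The n^2 entries of the corner then contribute at most d in total; n+1 also covers n = 0. *)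
  pose d' := d / n.+1%:R / n.+1%:R.
  have d'0 : 0 < d' by rewrite !divr_gt0.
  have Fd : F [set y : cmat | forall i j : 'I_n, `|y i j - l i j| < d'].
    apply: filter_forall => i; apply: filter_forall => j; exact: lF.
  have [y [xy yl]] := filter_ex (filterI Fx Fd).
  rewrite -[_ - l](subrKA (y : nat -> nat -> R[i]^o)) mformD.
  rewrite (le_trans (ler_normD _ _)) // lerD //.
    rewrite -ball_normE /= in xy.
    have /cmat_norm_leP := ltW xy; exact.
  rewrite -mform_mtrunc_id.
  rewrite (le_trans (mbound_mtrunc_sum _ _ u1 v1)) //.
  apply: (@le_trans _ _ (\sum_(i < n) \sum_(j < n) d')).
    by apply: ler_sum => i _; apply: ler_sum => j _; exact: ltW (yl i j).
  rewrite !sumr_const !card_ord -mulrnA -mulr_natr natrM /d'.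
  have n1 : n%:R / n.+1%:R <= 1 :> R[i] by rewrite ler_pdivrMr ?mul1r ?ler_nat.
  have n0 : 0 <= n%:R / n.+1%:R :> R[i] by rewrite divr_ge0.
  rewrite (_ : _ * _ = d * ((n%:R / n.+1%:R) * (n%:R / n.+1%:R))); last by ring.
  by apply: ler_piMr; [exact: ltW|rewrite mulr_ile1].
have lcpt : l \in compact_matrix.
  apply/compact_matrixP => e e0.
  have e3 : 0 < e / 3%:R by rewrite divr_gt0.
  have [x Fx] := cF _ e3; have xl := near_l x _ Fx.
  have /compact_matrixP/(_ _ e3)[m mP] := cmat_compact x.
  exists m => n /mP xn.
  (* The compactness of x is transferred to l: each of the three terms is bounded by e / 3. *)
  rewrite (_ : l - mtrunc n l = - ((x : nat -> nat -> R[i]^o) - l) +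
    ((x : nat -> nat -> R[i]^o) - mtrunc n x) +
    mtrunc n ((x : nat -> nat -> R[i]^o) - l)); last first.
    by rewrite mtruncB opprB !subrKA.
  rewrite (_ : e = e / 3%:R + e / 3%:R + e / 3%:R); last by field.
  apply: mboundD (mbound_trunc n xl); apply: mboundD xn; exact: mboundN.
apply/cvg_ex; exists (CMat lcpt); apply/cvg_ballP => e e0.
have e2 : 0 < e / 2 by rewrite divr_gt0.
have [x Fx] := cF _ e2; apply: filterS (Fx) => y; rewrite -!ball_normE /= => xy.
rewrite -(subrKA x) (le_lt_trans (ler_normD _ _)) // (splitr e).
rewrite ler_ltD // distrC; apply/cmat_norm_leP; exact: near_l.
Qed.

HB.instance Definition _ := Uniform_isComplete.Build cmat cmat_complete.

End CompactMatrices.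

(** * Limits of sequences in normed modules *)

Section NormedLimits.
Variables (K : numFieldType).

Lemma cvg_norm_le (V : normedModType K) (u : nat -> V) (l : V) (r : K) :
  u @ \oo --> l -> (forall n, `|u n| <= r) -> `|l| <= r.
Proof.
move=> ul ur; apply/ler_addgt0Pr => e e0.
move/cvgrPdist_lt: ul => /(_ e e0) ul; have [n ln] := filter_ex ul.
by rewrite -(subrK (u n) l) (le_trans (ler_normD _ _)) // addrC lerD // ltW.
Qed.

Lemma cvg_norm_sqr (V W : normedModType K) (u : nat -> V) (w : nat -> W) l m :
  u @ \oo --> l -> w @ \oo --> m -> (forall n, `|u n| = `|w n| ^+ 2) ->
  `|l| = `|m| ^+ 2.
Proof.
move=> /cvg_norm ul /cvg_norm wm uw.
have w2m : `|w n| ^+ 2 @[n --> \oo] --> `|m| ^+ 2.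
  by rewrite expr2; under eq_fun do rewrite expr2; exact: cvgM.
have -> : `|l| = lim (`|w n| ^+ 2 @[n --> \oo]).
  by apply/esym/cvg_lim => //; under eq_fun do rewrite -uw.
exact/cvg_lim.
Qed.

Lemma cvg_dist0 (V : normedModType K) (u : nat -> V) (l : V) :
  (forall e : K, 0 < e -> exists m, forall n, (m <= n)%N -> `|l - u n| <= e) ->
  u @ \oo --> l.
Proof.
move=> ul; apply/cvgrPdist_le => e e0; have [m mP] := ul e e0.
by exists m => // n /= mn; exact: mP.
Qed.

Lemma cauchy_seq_cvg (V : completeNormedModType K) (u : nat -> V) :
  (forall e : K, 0 < e -> exists m, forall n, (m <= n)%N -> `|u n - u m| <= e) ->
  cvg (u @ \oo).
Proof.
move=> cu; apply: cauchy_cvg; apply/cauchyP => e e0.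
have e2 : 0 < e / 2 by rewrite divr_gt0.
have [m mP] := cu _ e2; exists (u m), m => // n /= /mP.
rewrite -ball_normE /= distrC => /le_lt_trans; apply.
by rewrite [ltRHS](splitr e) ltrDl.
Qed.

Lemma norm_cvg_unique (V : normedModType K) (u : nat -> V) (l m : V) :
  u @ \oo --> l -> u @ \oo --> m -> l = m.
Proof. by move=> ul um; apply: (cvg_unique _ ul um). Qed.

Lemma small_factor (e M : K) : 0 < e -> 0 <= M -> exists2 d, 0 < d & d * M <= e.
Proof.
move=> e0 M0; have M1 : 0 < M + 1 by rewrite ltr_wpDl.
exists (e / (M + 1)); first by rewrite divr_gt0.
by rewrite mulrAC ler_pdivrMr // ler_pM2l // lerDl.
Qed.

Lemma nonexpansive_cvg (V W : normedModType K) (f : V -> W) (u : nat -> V) x :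
  (forall y z, `|f y - f z| <= `|y - z|) ->
  u @ \oo --> x -> f (u n) @[n --> \oo] --> f x.
Proof.
move=> cf ux; apply/cvgrPdist_le => e e0.
move/cvgrPdist_le: ux => /(_ e e0); apply: filterS => n; exact: le_trans.
Qed.

(** A bare map m is used because the result serves to prove [cmul] associative, before it becomes an
    algebra product, and again for the product of a C*-algebra. *)
Lemma bilinear_cvg (V : normedModType K) (m : V -> V -> V) (u v : nat -> V) x y :
  (forall a b c, m (a - b) c = m a c - m b c) ->
  (forall a b c, m c (a - b) = m c a - m c b) ->
  (forall a b, `|m a b| <= `|a| * `|b|) ->
  u @ \oo --> x -> v @ \oo --> y -> m (u n) (v n) @[n --> \oo] --> m x y.
Proof.
move=> mBl mBr m_le ux vy; apply/cvgrPdist_le => e e0.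
have e2 : 0 < e / 2 by rewrite divr_gt0.
have [d d0 de] := small_factor e2 (normr_ge0 x).
have [c c0 ce] := small_factor e2 (addr_ge0 (normr_ge0 y) ler01).
move/cvgrPdist_le: (vy) => /(_ d d0) vd; move/cvgrPdist_le: ux => /(_ c c0) uc.
(* Eventually |v n| <= |y| + 1, whence the added 1 in the choice of c. *)
move/cvgrPdist_le: vy => /(_ 1 ltr01) v1.
near=> n.
rewrite -(subrKA (m x (v n))) -mBr -mBl.
rewrite (le_trans (ler_normD _ _)) // (splitr e) lerD //.
  rewrite (le_trans (m_le _ _)) // mulrC (le_trans _ de) // ler_wpM2r //.
  by near: n.
rewrite (le_trans (m_le _ _)) // (le_trans _ ce) // ler_pM //.
  by near: n.
rewrite -[v n](subrKC y) addrC (le_trans (ler_normD _ _)) // addrC lerD //.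
by rewrite distrC; near: n.
Unshelve. all: by end_near. Qed.

End NormedLimits.

(** * Algebra of corner products *)

Section MatrixProduct.
Variable C : numClosedFieldType.
Implicit Types a b c : nat -> nat -> C^o.

Lemma mmulE n a b i j : mmul n a b i j =
  if (i < n)%N && (j < n)%N then \sum_(k < n) a i k * b k j else 0.
Proof. by []. Qed.

Lemma mmulDl n a b c : mmul n (a + b) c = mmul n a c + mmul n b c.
Proof.
rewrite /mmul -mtruncD; congr mtrunc; apply/funext => i; apply/funext => j.
rewrite -[RHS]/(_ + _) -big_split; apply: eq_bigr => k _; exact: mulrDl.
Qed.

Lemma mmulDr n a b c : mmul n c (a + b) = mmul n c a + mmul n c b.
Proof.
rewrite /mmul -mtruncD; congr mtrunc; apply/funext => i; apply/funext => j.
rewrite -[RHS]/(_ + _) -big_split; apply: eq_bigr => k _; exact: mulrDr.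
Qed.

Lemma mmulZl n (k : C) a b : mmul n (k *: a) b = k *: mmul n a b.
Proof.
rewrite /mmul -mtruncZ; congr mtrunc; apply/funext => i; apply/funext => j.
rewrite -[RHS]/(_ *: _) scaler_sumr; apply: eq_bigr => l _.
by rewrite -[(k *: a) i l]/(k * a i l) -mulrA.
Qed.

Lemma mmulZr n (k : C) a b : mmul n a (k *: b) = k *: mmul n a b.
Proof.
rewrite /mmul -mtruncZ; congr mtrunc; apply/funext => i; apply/funext => j.
rewrite -[RHS]/(_ *: _) scaler_sumr; apply: eq_bigr => l _.
by rewrite -[(k *: b) l j]/(k * b l j) mulrCA.
Qed.

Lemma mmul_mtrunc m n a b : (m <= n)%N ->
  mmul n (mtrunc m a) (mtrunc m b) = mmul m a b.
Proof.
move=> mn; apply/funext => i; apply/funext => j; rewrite !mmulE /mtrunc.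
case: (ltnP i m) => im /=; last first.
  by rewrite big1 ?if_same // => k _; rewrite mul0r.
case: (ltnP j m) => jm /=; last first.
  by rewrite big1 ?if_same // => k _; rewrite andbF mulr0.
rewrite (leq_trans im mn) (leq_trans jm mn) /=.
rewrite (big_ord_widen n (fun k => a i k * b k j) mn) [RHS]big_mkcond /=.
by apply: eq_bigr => k _; rewrite andbT; case: ifP => // _; rewrite mul0r.
Qed.

Lemma mmulA n a b c : mmul n a (mmul n b c) = mmul n (mmul n a b) c.
Proof.
apply/funext => i; apply/funext => j; rewrite ![LHS]mmulE ![RHS]mmulE.
case: ifP => // /andP[iN jN].
transitivity (\sum_(k < n) \sum_(l < n) a i k * (b k l * c l j)).
  by apply: eq_bigr => k _; rewrite mmulE ltn_ord jN mulr_sumr.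
rewrite exchange_big; apply: eq_bigr => l _.
by rewrite mmulE ltn_ord iN mulr_suml; apply: eq_bigr => k _; rewrite mulrA.
Qed.

Lemma madj_mmul n a b : madj (mmul n a b) = mmul n (madj b) (madj a).
Proof.
apply/funext => i; apply/funext => j; rewrite /madj !mmulE andbC.
case: ifP => _; last by rewrite conjC0.
by rewrite rmorph_sum; apply: eq_bigr => k _; rewrite rmorphM mulrC.
Qed.

Lemma mtrunc_mmul n a b : mtrunc n (mmul n a b) = mmul n a b.
Proof. exact: mtrunc_id. Qed.

End MatrixProduct.

(** * Product, adjoint and C*-identity for compact matrices *)

Section CompactAlgebra.
Variable R : realType.
Implicit Types x y z : cmat R.

Definition ctrunc n x : cmat R :=
  CMat (introT (compact_matrixP _) (mcompact_mtrunc n x)).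

Definition cmuln n x y : cmat R :=
  CMat (introT (compact_matrixP _) (mcompact_mtrunc n
    (fun i j => \sum_(k < n) x i k * y k j))).

Lemma cmatP x y : cmat_val x = cmat_val y -> x = y. Proof. exact: val_inj. Qed.

Lemma cmuln_val n x y : cmat_val (cmuln n x y) = mmul n x y. Proof. by []. Qed.

Lemma ctrunc_norm n x : `|ctrunc n x| <= `|x|.
Proof. by apply/cmat_norm_leP/mbound_trunc; exact: mbound_norm. Qed.

Lemma ctrunc_near x (e : R[i]) : 0 < e ->
  exists m, forall n, (m <= n)%N -> `|x - ctrunc n x| <= e.
Proof.
move=> e0; have /compact_matrixP/(_ e e0)[m mP] := cmat_compact x.
by exists m => n /mP xn; apply/cmat_norm_leP.
Qed.

Lemma ctrunc_cvg x : ctrunc n x @[n --> \oo] --> x.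
Proof. by apply: cvg_dist0 => e; exact: ctrunc_near. Qed.
Arguments ctrunc_cvg : clear implicits.

Lemma cmuln_norm n x y : `|cmuln n x y| <= `|x| * `|y|.
Proof. by apply/cmat_norm_leP/mbound_mmul; exact: mbound_norm. Qed.

Lemma cmulnDl n x y z : cmuln n (x + y) z = cmuln n x z + cmuln n y z.
Proof. by apply: cmatP; rewrite !(cmat_valD, cmuln_val) mmulDl. Qed.

Lemma cmulnDr n x y z : cmuln n z (x + y) = cmuln n z x + cmuln n z y.
Proof. by apply: cmatP; rewrite !(cmat_valD, cmuln_val) mmulDr. Qed.

Lemma cmulnZl n (k : R[i]) x y : cmuln n (k *: x) y = k *: cmuln n x y.
Proof. by apply: cmatP; rewrite !(cmat_valZ, cmuln_val) mmulZl. Qed.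

Lemma cmulnZr n (k : R[i]) x y : cmuln n x (k *: y) = k *: cmuln n x y.
Proof. by apply: cmatP; rewrite !(cmat_valZ, cmuln_val) mmulZr. Qed.

Lemma cmulnBl n x y z : cmuln n (x - y) z = cmuln n x z - cmuln n y z.
Proof. by rewrite cmulnDl -[- y]scaleN1r cmulnZl scaleN1r. Qed.

Lemma cmulnBr n x y z : cmuln n z (x - y) = cmuln n z x - cmuln n z y.
Proof. by rewrite cmulnDr -[- y]scaleN1r cmulnZr scaleN1r. Qed.

Lemma cmuln_ctrunc m n x y : (m <= n)%N ->
  cmuln n (ctrunc m x) (ctrunc m y) = cmuln m x y.
Proof. by move=> mn; apply: cmatP; rewrite !cmuln_val mmul_mtrunc. Qed.

(** By [cmuln_ctrunc] the m-th product is also the n-th product of the m-truncations, for m <= n.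
    The difference is then controlled by the distances of x and y to their truncations. *)
Lemma cmuln_is_cvg x y : cvg (cmuln n x y @[n --> \oo]).
Proof.
apply: cauchy_seq_cvg => e e0.
have [d d0 de] := small_factor e0 (addr_ge0 (normr_ge0 x) (normr_ge0 y)).
have [m1 m1P] := ctrunc_near x d0; have [m2 m2P] := ctrunc_near y d0.
exists (maxn m1 m2) => n mn; set m := maxn m1 m2 in mn *.
rewrite -(cmuln_ctrunc x y mn) -(subrKA (cmuln n (ctrunc m x) y)).
rewrite -cmulnBl -cmulnBr (le_trans (ler_normD _ _)) // (le_trans _ de) //.
rewrite mulrDr addrC lerD // (le_trans (cmuln_norm _ _ _)) //.
  rewrite mulrC ler_pM //; [exact/m2P/leq_maxr|exact: ctrunc_norm].
by rewrite ler_wpM2r //; exact/m1P/leq_maxl.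
Qed.

(* The rows and columns of compact matrices are square-summable only, so the
   product is defined as a norm limit of products of truncations. *)
Definition cmul x y : cmat R := lim (cmuln n x y @[n --> \oo]).

Lemma cmul_cvg x y : cmuln n x y @[n --> \oo] --> cmul x y.
Proof. exact: cmuln_is_cvg. Qed.
Arguments cmul_cvg : clear implicits.

Lemma cmul_norm x y : `|cmul x y| <= `|x| * `|y|.
Proof. by apply: (cvg_norm_le (cmul_cvg x y)) => n; exact: cmuln_norm. Qed.

Lemma cmulDl x y z : cmul (x + y) z = cmul x z + cmul y z.
Proof.
apply: (norm_cvg_unique (cmul_cvg _ _)).
by under eq_fun do rewrite cmulnDl; apply: cvgD; exact: cmul_cvg.
Qed.

Lemma cmulDr x y z : cmul z (x + y) = cmul z x + cmul z y.
Proof.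
apply: (norm_cvg_unique (cmul_cvg _ _)).
by under eq_fun do rewrite cmulnDr; apply: cvgD; exact: cmul_cvg.
Qed.

Lemma cmulZl (k : R[i]) x y : cmul (k *: x) y = k *: cmul x y.
Proof.
apply: (norm_cvg_unique (cmul_cvg _ _)).
by under eq_fun do rewrite cmulnZl; apply: cvgZr; exact: cmul_cvg.
Qed.

Lemma cmulZr (k : R[i]) x y : cmul x (k *: y) = k *: cmul x y.
Proof.
apply: (norm_cvg_unique (cmul_cvg _ _)).
by under eq_fun do rewrite cmulnZr; apply: cvgZr; exact: cmul_cvg.
Qed.

Lemma cmul_ctrunc n x y : cmul (ctrunc n x) (ctrunc n y) = cmuln n x y.
Proof.
apply: (norm_cvg_unique (cmul_cvg _ _)); apply: cvg_dist0 => e e0.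
by exists n => k nk; rewrite cmuln_ctrunc // subrr normr0 ltW.
Qed.

Lemma ctrunc_cmuln n x y : ctrunc n (cmuln n x y) = cmuln n x y.
Proof. by apply/val_inj; exact: mtrunc_mmul. Qed.

Lemma cmul_cvg2 (u v : nat -> cmat R) x y : u @ \oo --> x -> v @ \oo --> y ->
  cmul (u n) (v n) @[n --> \oo] --> cmul x y.
Proof.
apply: bilinear_cvg => [a b c|a b c|]; last exact: cmul_norm.
  by rewrite cmulDl -[- b]scaleN1r cmulZl scaleN1r.
by rewrite cmulDr -[- b]scaleN1r cmulZr scaleN1r.
Qed.

(** On truncations of x, y and z both bracketings are products inside one corner, where
    associativity is that of finite matrices; continuity of [cmul] passes to the limit. *)
Lemma cmulA : associative cmul.
Proof.
move=> x y z.
have xyz : cmul (ctrunc n x) (cmul (ctrunc n y) (ctrunc n z)) @[n --> \oo] -->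
    cmul x (cmul y z).
  by do 2![apply: cmul_cvg2; first exact: ctrunc_cvg]; exact: ctrunc_cvg.
apply: (norm_cvg_unique xyz).
rewrite (_ : (fun n => _) =
    fun n => cmul (cmul (ctrunc n x) (ctrunc n y)) (ctrunc n z)).
  by do 2![apply: cmul_cvg2; last exact: ctrunc_cvg]; exact: ctrunc_cvg.
apply/funext => n; rewrite !cmul_ctrunc -(ctrunc_cmuln n y) -(ctrunc_cmuln n x).
by rewrite !cmul_ctrunc; apply/val_inj; exact: mmulA.
Qed.

HB.instance Definition _ := Lmodule_isNonUnitalAlgebra.Build R[i] (cmat R)
  cmulA cmulDl (fun z x y => cmulDr x y z) cmulZl cmulZr.

Lemma mcompact_madj x : mcompact (madj x).
Proof.
move=> e e0; have /compact_matrixP/(_ e e0)[m mP] := cmat_compact x.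
exists m => n /mP /mbound_adj; rewrite mtrunc_adj; congr mbound.
by apply/funext => i; apply/funext => j; rewrite /madj -[RHS]/(_ - _) -rmorphB.
Qed.

Definition cadj x : cmat R := CMat (introT (compact_matrixP _) (mcompact_madj x)).

Lemma cadj_val x : cmat_val (cadj x) = madj x. Proof. by []. Qed.

Lemma cadjK : involutive cadj.
Proof.
by move=> x; apply/val_inj/funext => i; apply/funext => j /=; rewrite /madj conjCK.
Qed.

Lemma cadjD : {morph cadj : x y / x + y}.
Proof.
by move=> x y; apply/val_inj/funext => i; apply/funext => j; exact: rmorphD.
Qed.

Lemma cadjZ (k : R[i]) x : cadj (k *: x) = k^* *: cadj x.
Proof.
apply: cmatP; rewrite cmat_valZ !cadj_val cmat_valZ.
by apply/funext => i; apply/funext => j; exact: rmorphM.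
Qed.

Lemma cadj_norm x : `|cadj x| = `|x|.
Proof.
suff le_adj y : `|cadj y| <= `|y|.
  by apply/eqP; rewrite eq_le le_adj -{1}(cadjK x) le_adj.
by apply/cmat_norm_leP/mbound_adj; exact: mbound_norm.
Qed.

Lemma cadj_ctrunc n x : cadj (ctrunc n x) = ctrunc n (cadj x).
Proof. by apply/val_inj; rewrite /= mtrunc_adj. Qed.

Lemma cadj_cmuln n x y : cadj (cmuln n x y) = cmuln n (cadj y) (cadj x).
Proof. by apply/val_inj; exact: madj_mmul. Qed.

Lemma cadj_cvg (u : nat -> cmat R) x :
  u @ \oo --> x -> cadj (u n) @[n --> \oo] --> cadj x.
Proof.
apply: nonexpansive_cvg => y z.
by rewrite -[- cadj _]scaleN1r -(rmorphN1 Num.conj) -cadjZ -cadjD cadj_norm scaleN1r.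
Qed.

Lemma cadjM x y : cadj (x ⋅ y) = cadj y ⋅ cadj x.
Proof.
apply: (norm_cvg_unique (cadj_cvg (cmul_cvg x y))).
by under eq_fun do rewrite cadj_cmuln; exact: cmul_cvg.
Qed.

(** The identity already holds for the n-th truncation: one inequality is submultiplicativity, the
    other is [mbound_cstar]. Both norms converge. *)
Lemma cmat_cstar_identity x : `|cadj x ⋅ x| = `|x| ^+ 2.
Proof.
apply: (cvg_norm_sqr (cmul_cvg (cadj x) x) (ctrunc_cvg x)) => n.
apply/eqP; rewrite eq_le; apply/andP; split.
  rewrite -(cmuln_ctrunc _ _ (leqnn n)) (le_trans (cmuln_norm _ _ _)) //.
  by rewrite -cadj_ctrunc cadj_norm expr2.
rewrite -(sqrtCK `|cmuln n (cadj x) x|) ler_pXn2r ?nnegrE ?sqrtC_ge0 //.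
by apply/cmat_norm_leP/mbound_cstar; exact: mbound_norm (cmuln n (cadj x) x).
Qed.

HB.instance Definition _ := NonUnitalAlgebra_isCStarAlgebra.Build R (cmat R)
  cadjK cadjD cadjZ cadjM cmul_norm cmat_cstar_identity.

End CompactAlgebra.

(** * The star graph *)
(** It makes the matrix unit calculus of Leavitt families available in C*-algebras. *)
Lemma cuntz_krieger_leavitt (R : realType) (E : graph) (A : cstarAlgType R)
    (p : vertex E -> A) (s : edge E -> A) :
  cuntz_krieger_family p s -> leavitt_family p s (fun e => (s e)^★).
Proof.
move=> ck.
have pstar v : (p v)^★ = p v by case: (ck_projection ck v).
have sss e : s e ⋅ (s e)^★ ⋅ s e = s e by exact: ck_partial_isometry ck e.
have stss e : (s e)^★ ⋅ (s e ⋅ (s e)^★) = (s e)^★.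
  by rewrite -[RHS](congr1 astar (sss e)) !astarM astarK.
have srcl e : p (source_of e) ⋅ s e = s e.
  have := congr1 astar (ck_source ck e).
  rewrite !astarM astarK pstar => psst.
  by rewrite -{1}(sss e) amulA psst sss.
have rngr e : s e ⋅ p (range_of e) = s e.
  by rewrite -(ck_range ck) amulA sss.
split=> //.
- by move=> v; case: (ck_projection ck v).
- exact: ck_orth ck.
- by move=> e; rewrite -[RHS](congr1 astar (rngr e)) astarM pstar.
- by move=> e; rewrite -[RHS](congr1 astar (srcl e)) astarM pstar.
- move=> e f; case: eqVneq => [->|ne_ef]; first exact: ck_range ck f.
  (* The range projections of e and f are inserted between s_e^★ and s_f; their product is 0. *)
  rewrite -(stss e) -{1}(sss f) -!amulA (amulA (s e)) (amulA (s e ⋅ _)).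
  by rewrite !amulA -(amulA _ (s f)) -(amulA (s e)^★) -(amulA (s e)^★)
    (ck_orth_ranges ck ne_ef) amul0r amul0l.
- exact: ck_regular ck.
Qed.

(* Every leaf emits one edge to the centre 0: n -> 0 is the edge n.-1. *)
Definition star_graph : graph := @Graph nat nat (fun=> 0%N) S.

Lemma emitted_star_leaf (n : nat) : @emitted star_graph n.+1 = [set n].
Proof. by apply/seteqP; split=> k /= => [[]|->]. Qed.

Lemma emitted_star_centre : @emitted star_graph 0%N = set0.
Proof. by apply/seteqP; split. Qed.

Lemma star_graph_row_finite : row_finite star_graph.
Proof.
by case=> [|n]; rewrite ?emitted_star_centre ?emitted_star_leaf.
Qed.

Lemma star_leaf_regular (n : nat) : @regular_vertex star_graph n.+1.
Proof. by rewrite /regular_vertex emitted_star_leaf; split=> //; exists n. Qed.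

(** * Matrix units from a Leavitt family of the star graph *)

Section MatrixUnits.
Variables (K : pzRingType) (B : nonUnitalAlgType K).
Variables (p : vertex star_graph -> B) (s t : edge star_graph -> B).
Hypothesis lf : leavitt_family p s t.

(** Units of column 0: edge k leaves the leaf k+1, and the vertex idempotent of the centre fills
    position 0. *)
Definition unit_col (i : nat) : B := if i is k.+1 then s k else p 0%N.
Definition unit_row (i : nat) : B := if i is k.+1 then t k else p 0%N.
Definition matrix_unit i j : B := unit_col i ⋅ unit_row j.

Lemma unit_row_col i j : unit_row i ⋅ unit_col j = if i == j then p 0%N else 0.
Proof.
case: i j => [|i] [|j] /=; first exact: leavitt_idem lf _.
- by rewrite -(leavitt_sourcel lf) amulA (leavitt_orth lf) ?amul0l.
- by rewrite -(leavitt_sourcer lf) -amulA (leavitt_orth lf) ?amul0r.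
- exact: leavitt_CK1 lf i j.
Qed.

Lemma unit_col_centre i : unit_col i ⋅ p 0%N = unit_col i.
Proof. by case: i => [|i]; [exact: leavitt_idem lf _|exact: leavitt_ranger lf i]. Qed.

Lemma matrix_unitM i j k l :
  matrix_unit i j ⋅ matrix_unit k l = if j == k then matrix_unit i l else 0.
Proof.
rewrite /matrix_unit amulA -(amulA (unit_col i)) unit_row_col.
by case: eqP => _; rewrite ?unit_col_centre ?amul0r ?amul0l.
Qed.

(** At a leaf this is the relation at a regular vertex, whose sum has a single term. *)
Lemma matrix_unit_vertex v : matrix_unit v v = p v.
Proof.
case: v => [|n]; first exact: leavitt_idem lf _.
by rewrite (leavitt_CK2 lf (star_leaf_regular n)) emitted_star_leaf fsbig_set1.
Qed.

Lemma matrix_unit_edge n : matrix_unit n.+1 0 = s n.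
Proof. exact: leavitt_ranger lf n. Qed.

Lemma matrix_unit_ghost n : matrix_unit 0 n.+1 = t n.
Proof. exact: leavitt_rangel lf n. Qed.

End MatrixUnits.

Section MatrixSum.
Variables (C : numClosedFieldType) (B : nonUnitalAlgType C).
Variable u : nat -> nat -> B.
Implicit Types a b : nat -> nat -> C^o.

Definition mxsum n a : B := \sum_(i < n) \sum_(j < n) a i j *: u i j.

Lemma mxsumD n a b : mxsum n (a + b) = mxsum n a + mxsum n b.
Proof.
rewrite /mxsum -big_split; apply: eq_bigr => i _.
by rewrite -big_split; apply: eq_bigr => j _; exact: scalerDl.
Qed.

Lemma mxsumZ n (k : C) a : mxsum n (k *: a) = k *: mxsum n a.
Proof.
rewrite /mxsum scaler_sumr; apply: eq_bigr => i _.
by rewrite scaler_sumr; apply: eq_bigr => j _; rewrite scalerA.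
Qed.

Lemma mxsum_mtrunc m n a : (m <= n)%N -> mxsum n (mtrunc m a) = mxsum m a.
Proof.
move=> mn; rewrite /mxsum.
rewrite (@sum_widen _ m n (fun i => \sum_(j < n) mtrunc m a i j *: u i j)) //.
  apply: eq_bigr => i _.
  rewrite (@sum_widen _ m n (fun j => mtrunc m a i j *: u i j)) //.
    by apply: eq_bigr => j _; rewrite /mtrunc !ltn_ord.
  by move=> j mj; rewrite /mtrunc [(j < m)%N]ltnNge mj andbF scale0r.
by move=> i mi; rewrite big1 // => j _; rewrite /mtrunc ltnNge mi scale0r.
Qed.

(** The sum over a finite matrix does not depend on the corner chosen to contain it. *)
Lemma mxsum_support m n a : mtrunc m a = a -> mtrunc n a = a ->
  mxsum m a = mxsum n a.
Proof.
move=> ma na; rewrite -(mxsum_mtrunc a (leq_maxl m n)) ma.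
by rewrite -{1}na (mxsum_mtrunc a (leq_maxr m n)).
Qed.

Hypothesis uM : forall i j k l, u i j ⋅ u k l = if j == k then u i l else 0.

Lemma mxsumM n a b : mxsum n (mmul n a b) = mxsum n a ⋅ mxsum n b.
Proof.
rewrite /mxsum amul_suml; apply: eq_bigr => i _.
rewrite amul_suml.
transitivity (\sum_(j < n) \sum_(k < n) (a i k * b k j) *: u i j).
  apply: eq_bigr => j _; rewrite -scaler_suml; congr (_ *: _).
  by rewrite mmulE !ltn_ord.
rewrite exchange_big; apply: eq_bigr => k _.
rewrite amul_sumr [RHS](bigD1 k) //= [X in _ + X]big1 ?addr0 => [|l ne_lk].
  rewrite amul_sumr; apply: eq_bigr => j _.
  by rewrite amulZl amulZr uM eqxx scalerA.
rewrite amul_sumr big1 // => j _; rewrite amulZl amulZr uM.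
by rewrite eq_sym -[(_ == _) in LHS]/(l == k) (negPf ne_lk) !scaler0.
Qed.

End MatrixSum.

(** * Matrix units among the compact matrices *)

Section CompactMatrixUnits.
Variable R : realType.

Definition delta_matrix i j : nat -> nat -> R[i]^o :=
  fun k l => ((k == i) && (l == j))%:R.

Lemma mtrunc_delta n i j : (i < n)%N -> (j < n)%N ->
  mtrunc n (delta_matrix i j) = delta_matrix i j.
Proof.
move=> i_n j_n; apply/funext => k; apply/funext => l; rewrite /mtrunc /delta_matrix.
case: (eqVneq k i) => [->|_] /=; last by rewrite if_same.
by case: (eqVneq l j) => [->|_] /=; rewrite ?i_n ?j_n ?if_same.
Qed.

Lemma mcompact_delta i j : mcompact (delta_matrix i j).
Proof.
rewrite -(@mtrunc_delta (maxn i j).+1) ?ltnS ?leq_maxl ?leq_maxr //.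
exact: mcompact_mtrunc.
Qed.

Definition cunit i j : cmat R := CMat (introT (compact_matrixP _) (mcompact_delta i j)).

Lemma ctrunc_cunit n i j : (i < n)%N -> (j < n)%N -> ctrunc n (cunit i j) = cunit i j.
Proof. by move=> i_n j_n; apply: cmatP; exact: mtrunc_delta. Qed.

Lemma cmul_support n (x y : cmat R) : ctrunc n x = x -> ctrunc n y = y ->
  x ⋅ y = cmuln n x y.
Proof. by move=> nx ny; rewrite -{1}nx -{1}ny; exact: cmul_ctrunc. Qed.

Lemma cunitM i j k l : cunit i j ⋅ cunit k l = if j == k then cunit i l else 0.
Proof.
pose n := (maxn (maxn i j) (maxn k l)).+1.
have [in' jn kn ln] : [/\ (i < n)%N, (j < n)%N, (k < n)%N & (l < n)%N].
  by rewrite !ltnS !leq_max !leqnn ?orbT.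
rewrite (@cmul_support n) ?ctrunc_cunit //; apply: cmatP; rewrite cmuln_val.
apply/funext => a; apply/funext => b; rewrite mmulE.
transitivity (((a == i) && (b == l) && (j == k))%:R : R[i]); last first.
  by case: (j == k); rewrite ?andbT ?andbF.
case: ifP => [_|]; last first.
  move=> abn; case: (eqVneq a i) => //= ai; case: (eqVneq b l) => //= bl.
  by move: abn; rewrite ai bl in' ln.
rewrite (bigD1 (Ordinal jn)) //= big1 ?addr0 => [|c /negPf].
  rewrite /delta_matrix eqxx andbT -natrM mulnb; congr ((nat_of_bool _)%:R).
  by case: (a == i); case: (b == l); case: (j == k).
by rewrite -val_eqE /= /delta_matrix => ->; rewrite andbF mul0r.
Qed.

Lemma cunit_star i j : (cunit i j)^★ = cunit j i.
Proof.
apply: cmatP; apply/funext => k; apply/funext => l.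
rewrite -[LHS]/((delta_matrix i j l k)^*) -[RHS]/(delta_matrix j i k l).
by rewrite /delta_matrix rmorph_nat andbC.
Qed.

Lemma ctrunc_cunitE n (x : cmat R) : ctrunc n x = mxsum cunit n x.
Proof.
apply: cmatP; apply/funext => k; apply/funext => l.
pose ent (z : cmat R) : R[i]^o := cmat_val z k l.
have entD : {morph ent : y z / y + z} by [].
have ent0 : ent 0 = 0 by [].
rewrite -[RHS]/(ent _) /mxsum (big_morph ent entD ent0).
under eq_bigr => i _ do rewrite (big_morph ent entD ent0).
have entE i j : ent (x i j *: cunit i j) = x i j * ((k == i) && (l == j))%:R by [].
rewrite -[LHS]/(mtrunc n x k l) /mtrunc.
under eq_bigr => i _ do under eq_bigr => j _ do rewrite entE.
case: ifP => [/andP[kn ln]|kln].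
  rewrite (bigD1 (Ordinal kn)) //= (bigD1 (Ordinal ln)) //= !eqxx mulr1.
  rewrite !big1 ?addr0 // => [i /negPf|j /negPf]; rewrite -val_eqE /= eq_sym => ->.
    by rewrite big1 // => j _; rewrite mulr0.
  by rewrite /= mulr0.
rewrite big1 // => i _; rewrite big1 // => j _.
case: eqP => /= [ki|_]; last by rewrite mulr0.
case: eqP => /= [lj|_]; last by rewrite mulr0.
by rewrite ki lj !ltn_ord in kln.
Qed.

Lemma cunit_cuntz_krieger : @cuntz_krieger_family R star_graph (cmat R)
  (fun v => cunit v v) (fun e => cunit e.+1 0).
Proof.
split=> [v|v w /negPf vw|e|e f /negPf ef|e|e|[|n]].
- by split; rewrite ?cunit_star ?cunitM ?eqxx.
- by rewrite cunitM vw.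
- by rewrite /partial_isometry cunit_star cunitM eqxx cunitM eqxx.
- by rewrite !cunit_star !cunitM /= eqSS ef.
- by rewrite cunit_star cunitM eqxx.
- by rewrite /projection_le cunit_star cunitM eqxx cunitM eqxx.
- by case; rewrite emitted_star_centre => _ [].
- by move=> _; rewrite emitted_star_leaf fsbig_set1 cunit_star cunitM.
Qed.

(** Column 0 and its adjoints yield all matrix units, hence all truncations, and these approximate
    every compact matrix. *)
Lemma cunit_generated (S : set (cmat R)) : closed_star_subalgebra S ->
  (forall v : nat, S (cunit v v)) -> (forall e : nat, S (cunit e.+1 0)) -> S = setT.
Proof.
move=> [[S0 SD SZ SM] Sstar Sclosed] Sv Se.
have Scol i : S (cunit i 0) by case: i.
have Su i j : S (cunit i j).
  have <- : cunit i 0 ⋅ (cunit j 0)^★ = cunit i j by rewrite cunit_star cunitM.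
  by apply: SM => //; exact: Sstar.
apply/seteqP; split=> // x _; move/closedP: Sclosed; apply=> e e0.
have e20 : 0 < e / 2 by rewrite divr_gt0.
have [n /(_ _ (leqnn n)) xn] := ctrunc_near x e20.
exists (ctrunc n x); last by rewrite (le_lt_trans xn) // [ltRHS](splitr e) ltrDl.
rewrite ctrunc_cunitE; apply: (big_ind S) => // i _.
by apply: (big_ind S) => // j _; exact: SZ.
Qed.

End CompactMatrixUnits.

Lemma mxsum_delta (R : realType) (B : nonUnitalAlgType R[i]) (u : nat -> nat -> B)
    n i j : (i < n)%N -> (j < n)%N -> mxsum u n (delta_matrix R i j) = u i j.
Proof.
move=> i_n j_n; rewrite /mxsum (bigD1 (Ordinal i_n)) //= (bigD1 (Ordinal j_n)) //=.
rewrite /delta_matrix !eqxx scale1r !big1 ?addr0 // => [k /negPf|k /negPf].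
  by rewrite -val_eqE /= => -> ; rewrite big1 // => l _; rewrite scale0r.
by rewrite -val_eqE /= => ->; rewrite scale0r.
Qed.

(** * Removing a constant by taking powers *)

Section PowerTrick.
Variable R : realType.

Lemma bernoulli_le (h : R) n : 0 <= h -> 1 + n%:R * h <= (1 + h) ^+ n.
Proof.
move=> h0; elim: n => [|n IH]; first by rewrite mul0r addr0 expr0.
rewrite exprSr (le_trans _ (ler_wpM2r _ IH)) ?addr_ge0 //.
have : 0 <= n%:R * h * h by rewrite !mulr_ge0.
rewrite -natr1; nra.
Qed.

(** If u > v > 0, the powers of u / v = 1 + h are unbounded by Bernoulli, yet k bounds them. *)
Lemma power_trick (u v k : R) : 0 <= u -> 0 <= v ->
  (forall n, u ^+ (2 ^ n) <= k * v ^+ (2 ^ n)) -> u <= v.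
Proof.
move=> u0 v0 H; rewrite leNgt; apply/negP => vu.
have [v_eq0|vN0] := eqVneq v 0.
  have := H 0%N; rewrite !expr1 v_eq0 mulr0 => uN.
  by move: vu; rewrite v_eq0 ltNge uN.
have v_gt0 : 0 < v by rewrite lt_def vN0.
pose h := u / v - 1.
have h0 : 0 < h by rewrite subr_gt0 ltr_pdivlMr // mul1r.
have Hh n : (1 + h) ^+ (2 ^ n) <= k.
  by rewrite /h subrKC expr_div_n ler_pdivrMr ?exprn_gt0.
have k0 : 0 <= k / h.
  apply: divr_ge0 (ltW h0); apply: le_trans (Hh 0%N).
  by rewrite expr1 addr_ge0 // ltW.
(* With k / h < N <= 2^N, Bernoulli makes the power of exponent 2^N exceed k. *)
have := archi_boundP k0; set N := Num.bound _ => kN.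
have := le_trans (bernoulli_le (2 ^ N) (ltW h0)) (Hh N).
apply/negP; rewrite -ltNge; rewrite ltr_pdivrMr // in kN.
rewrite (lt_trans kN) // (@le_lt_trans _ _ ((2 ^ N)%N%:R * h)) ?ltrDr //.
by rewrite (ler_wpM2r (ltW h0)) // ler_nat ltnW // ltn_expl.
Qed.

End PowerTrick.

(** * Extension of matrix units to all compact matrices *)

Section MatrixRepresentation.
Variables (R : realType) (B : cstarAlgType R) (u : nat -> nat -> B).
Hypothesis uM : forall i j k l, u i j ⋅ u k l = if j == k then u i l else 0.
Hypothesis u_star : forall i j, (u i j)^★ = u j i.
Implicit Types x y : cmat R.

Definition crep n x : B := mxsum u n x.

Lemma crepD n x y : crep n (x + y) = crep n x + crep n y.
Proof. by rewrite /crep cmat_valD mxsumD. Qed.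

Lemma crepZ n (k : R[i]) x : crep n (k *: x) = k *: crep n x.
Proof. by rewrite /crep cmat_valZ mxsumZ. Qed.

Lemma crepB n x y : crep n (x - y) = crep n x - crep n y.
Proof. by rewrite crepD -[- y]scaleN1r crepZ scaleN1r. Qed.

Lemma crep_ctrunc m n x : (m <= n)%N -> crep n (ctrunc m x) = crep m x.
Proof. exact: mxsum_mtrunc. Qed.

Lemma crepM n x y : crep n (cmuln n x y) = crep n x ⋅ crep n y.
Proof. by rewrite /crep cmuln_val mxsumM. Qed.

Lemma crep_star n x : crep n (x^★) = (crep n x)^★.
Proof.
rewrite /crep /mxsum (big_morph _ (@astarD _ B) (@astar0 _ B)).
under [RHS]eq_bigr => i _ do rewrite (big_morph _ (@astarD _ B) (@astar0 _ B)).
rewrite exchange_big; apply: eq_bigr => i _; apply: eq_bigr => j _.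
by rewrite astarZ u_star.
Qed.

(* A *-representation of matrices of a fixed size is bounded by some k; by the
   C*-identity the bound k can be replaced with its 2^m-th root for all m. *)
Lemma crep_norm n x : `|crep n x| <= `|x|.
Proof.
pose k := \sum_(i < n) \sum_(j < n) `|u i j|.
have k0 : 0 <= k by apply: sumr_ge0 => i _; exact: sumr_ge0.
have bound m : forall y, `|crep n y| ^+ (2 ^ m) <= k * `|y| ^+ (2 ^ m).
  elim: m => [|m IH] y.
    rewrite !expr1 /crep /mxsum (le_trans (ler_norm_sum _ _ _)) // mulr_suml.
    apply: ler_sum => i _; rewrite (le_trans (ler_norm_sum _ _ _)) // mulr_suml.
    apply: ler_sum => j _; rewrite normrZ mulrC ler_wpM2l //.
    exact: cmat_entry.
  (* The square of the norm at y is the norm at the corner product of y^★ and y, to which the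
     induction hypothesis applies with the same k. *)
  rewrite expnS !exprM -cstar_identity -crep_star -crepM (le_trans (IH _)) //.
  rewrite ler_wpM2l // ler_pXn2r ?nnegrE ?exprn_ge0 // ?expn_gt0 //.
  by rewrite (le_trans (cmuln_norm _ _ _)) // astar_norm expr2.
have ReE (z : R[i]) : 0 <= z -> (complex.Re z)%:C = z.
  by move=> z0; rewrite RRe_real ?ger0_real.
rewrite -(ReE _ (normr_ge0 (crep n x))) -(ReE _ (normr_ge0 x)) lecR.
apply: (@power_trick _ _ _ (complex.Re k)) => [||m].
- by rewrite -ler0c ReE.
- by rewrite -ler0c ReE.
- by rewrite -lecR rmorphM !rmorphXn /= !ReE.
Qed.

(** The n-th and m-th terms differ by the image of x minus its m-truncation, and [crep n] is
    contractive. *)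
Lemma crep_is_cvg x : cvg (crep n x @[n --> \oo]).
Proof.
apply: cauchy_seq_cvg => e e0; have [m mP] := ctrunc_near x e0.
exists m => n mn; rewrite -(crep_ctrunc x mn) -crepB.
exact: le_trans (crep_norm _ _) (mP m (leqnn m)).
Qed.

Definition cmap x : B := lim (crep n x @[n --> \oo]).

Lemma cmap_cvg x : crep n x @[n --> \oo] --> cmap x.
Proof. exact: crep_is_cvg. Qed.
Arguments cmap_cvg : clear implicits.

Lemma cmapD x y : cmap (x + y) = cmap x + cmap y.
Proof.
apply: (norm_cvg_unique (cmap_cvg (x + y))).
by rewrite /= (eq_cvg _ _ (fun n => crepD n x y)); apply: cvgD; exact: cmap_cvg.
Qed.

Lemma cmapZ (k : R[i]) x : cmap (k *: x) = k *: cmap x.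
Proof.
apply: (norm_cvg_unique (cmap_cvg (k *: x))).
by rewrite /= (eq_cvg _ _ (fun n => crepZ n k x)); apply: cvgZr; exact: cmap_cvg.
Qed.

Lemma cmap_norm x : `|cmap x| <= `|x|.
Proof. by apply: (cvg_norm_le (cmap_cvg x)) => n; exact: crep_norm. Qed.

Lemma cmap_contraction x y : `|cmap x - cmap y| <= `|x - y|.
Proof.
by rewrite -[- cmap y]scaleN1r -cmapZ -cmapD scaleN1r; exact: cmap_norm.
Qed.

Lemma cmap_support n x : ctrunc n x = x -> cmap x = crep n x.
Proof.
move=> nx; apply: (norm_cvg_unique (cmap_cvg x)); apply: cvg_dist0 => e e0.
by exists n => k nk; rewrite -{2}nx crep_ctrunc // subrr normr0 ltW.
Qed.

Lemma cmap_star x : cmap (x^★) = (cmap x)^★.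
Proof.
apply: (norm_cvg_unique (cmap_cvg (x^★))).
rewrite /= (eq_cvg _ _ (fun n => crep_star n x)).
have star_le (y z : B) : `|y^★ - z^★| <= `|y - z| by rewrite -astarB astar_norm.
exact: nonexpansive_cvg star_le (cmap_cvg x).
Qed.

(** Both sides are limits of the images of the corner products, on which [crep] is
    multiplicative. *)
Lemma cmapM x y : cmap (x ⋅ y) = cmap x ⋅ cmap y.
Proof.
have xy_cvg : cmap (cmuln n x y) @[n --> \oo] --> cmap (x ⋅ y).
  have := @nonexpansive_cvg R[i] (cmat R) B cmap (fun n => cmuln n x y) (x ⋅ y)
    cmap_contraction.
  by apply; exact: cmul_cvg.
apply: (norm_cvg_unique xy_cvg).
have cmapE n : cmap (cmuln n x y) = crep n x ⋅ crep n y.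
  by rewrite (cmap_support (ctrunc_cmuln n x y)) crepM.
rewrite /= (eq_cvg _ _ cmapE).
apply: bilinear_cvg (cmap_cvg x) (cmap_cvg y).
- by move=> a b c; rewrite amulBl.
- by move=> a b c; rewrite amulBr.
- exact: anormM.
Qed.

Lemma cmap_cunit i j : cmap (cunit R i j) = u i j.
Proof.
have [i_n j_n] : (i < (maxn i j).+1)%N /\ (j < (maxn i j).+1)%N.
  by rewrite !ltnS leq_maxl leq_maxr.
by rewrite (cmap_support (ctrunc_cunit R i_n j_n)); exact: mxsum_delta.
Qed.

End MatrixRepresentation.

(** * Models of C*(E) and of the Leavitt path algebra for the star graph *)

Section StarGraphAlgebras.
Variable R : realType.

Lemma cmat_universal (B : cstarAlgType R) (p : vertex star_graph -> B)
    (s : edge star_graph -> B) : cuntz_krieger_family p s ->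
  exists f : cmat R -> B, [/\ star_hom f, forall v, f (cunit R v v) = p v
    & forall e, f (cunit R e.+1 0) = s e].
Proof.
move=> /[dup] ck /cuntz_krieger_leavitt lf.
pose u := matrix_unit p s (fun e => (s e)^★).
have uM := matrix_unitM lf.
have col_star i : (unit_col p s i)^★ = unit_row p (fun e => (s e)^★) i.
  by case: i => [|i] //=; case: (ck_projection ck 0%N).
have u_star i j : (u i j)^★ = u j i.
  by rewrite /u /matrix_unit astarM -!col_star astarK.
exists (cmap u); split=> [|v|e].
- split; last by move=> x; exact: cmap_star.
  by split; [exact: cmapD|exact: cmapZ|exact: cmapM].
- by rewrite cmap_cunit //; exact: matrix_unit_vertex lf v.
- by rewrite cmap_cunit //; exact: matrix_unit_edge lf e.
Qed.

Definition star_gca : graph_cstar_algebra R star_graph :=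
  GraphCStarAlgebra (cunit_cuntz_krieger R) (@cunit_generated R) cmat_universal.

Definition finite_matrix : {pred cmat R} := fun x => `[< exists n, ctrunc n x = x >].

Lemma finite_matrixP (x : cmat R) :
  reflect (exists n, ctrunc n x = x) (x \in finite_matrix).
Proof. exact: asboolP. Qed.

Lemma ctruncD n (x y : cmat R) : ctrunc n (x + y) = ctrunc n x + ctrunc n y.
Proof. by apply: cmatP; rewrite cmat_valD -mtruncD. Qed.

Lemma ctruncZ n (k : R[i]) (x : cmat R) : ctrunc n (k *: x) = k *: ctrunc n x.
Proof. by apply: cmatP; rewrite cmat_valZ -mtruncZ -cmat_valZ. Qed.

Lemma ctrunc_le m n (x : cmat R) : (m <= n)%N -> ctrunc m x = x -> ctrunc n x = x.
Proof. by move=> mn mx; apply: cmatP; rewrite -mx; exact: mtrunc_id. Qed.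

Lemma finite_matrix_common (x y : cmat R) :
  x \in finite_matrix -> y \in finite_matrix ->
  exists n, ctrunc n x = x /\ ctrunc n y = y.
Proof.
move=> /finite_matrixP[m mx] /finite_matrixP[n ny]; exists (maxn m n).
by rewrite (ctrunc_le (leq_maxl _ _) mx) (ctrunc_le (leq_maxr _ _) ny).
Qed.

Lemma finite_matrix_submod_closed : submod_closed finite_matrix.
Proof.
split=> [|k x y fx fy]; apply/finite_matrixP.
  by exists 0%N; apply: (addIr (ctrunc 0 0)); rewrite -ctruncD !add0r.
have [n [nx ny]] := finite_matrix_common fx fy.
by exists n; rewrite ctruncD ctruncZ nx ny.
Qed.

HB.instance Definition _ :=
  GRing.isSubmodClosed.Build _ _ finite_matrix finite_matrix_submod_closed.

(** Finite matrices are taken inside the compact ones, so that the canonical embedding is just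
    [fmat_val]. *)
Record fmat := FMat { fmat_val : cmat R; fmat_finite : fmat_val \in finite_matrix }.

HB.instance Definition _ := [isSub for fmat_val].
HB.instance Definition _ := [Choice of fmat by <:].
HB.instance Definition _ := [SubChoice_isSubLmodule of fmat by <:].

Lemma fmat_valD (x y : fmat) : fmat_val (x + y) = fmat_val x + fmat_val y.
Proof. by []. Qed.

Lemma fmat_valZ (k : R[i]) (x : fmat) : fmat_val (k *: x) = k *: fmat_val x.
Proof. by []. Qed.

Lemma fmatP (x y : fmat) : fmat_val x = fmat_val y -> x = y.
Proof. exact: val_inj. Qed.

Lemma fmat_mul_finite (x y : fmat) : fmat_val x ⋅ fmat_val y \in finite_matrix.
Proof.
have [n [nx ny]] := finite_matrix_common (fmat_finite x) (fmat_finite y).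
by apply/finite_matrixP; exists n; rewrite (cmul_support nx ny) ctrunc_cmuln.
Qed.

Definition fmul (x y : fmat) : fmat := FMat (fmat_mul_finite x y).

Lemma fmul_val (x y : fmat) : fmat_val (fmul x y) = fmat_val x ⋅ fmat_val y.
Proof. by []. Qed.

Lemma fmulA : associative fmul.
Proof. by move=> x y z; apply: fmatP; rewrite !fmul_val amulA. Qed.

Lemma fmulDl : left_distributive fmul +%R.
Proof. by move=> x y z; apply: fmatP; rewrite !(fmat_valD, fmul_val) amulDl. Qed.

Lemma fmulDr : right_distributive fmul +%R.
Proof. by move=> x y z; apply: fmatP; rewrite !(fmat_valD, fmul_val) amulDr. Qed.

Lemma fmulZl (k : R[i]) (x y : fmat) : fmul (k *: x) y = k *: fmul x y.
Proof. by apply: fmatP; rewrite !(fmat_valZ, fmul_val) amulZl. Qed.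

Lemma fmulZr (k : R[i]) (x y : fmat) : fmul x (k *: y) = k *: fmul x y.
Proof. by apply: fmatP; rewrite !(fmat_valZ, fmul_val) amulZr. Qed.

HB.instance Definition _ := Lmodule_isNonUnitalAlgebra.Build R[i] fmat
  fmulA fmulDl fmulDr fmulZl fmulZr.

Lemma finite_matrix_cunit i j : cunit R i j \in finite_matrix.
Proof.
apply/finite_matrixP; exists (maxn i j).+1.
by rewrite ctrunc_cunit // ltnS ?leq_maxl ?leq_maxr.
Qed.

Definition funit i j : fmat := FMat (finite_matrix_cunit i j).

Lemma funitM i j k l : funit i j ⋅ funit k l = if j == k then funit i l else 0.
Proof.
apply: fmatP; rewrite -[LHS]/(cunit R i j ⋅ cunit R k l) cunitM.
by case: (j == k).
Qed.

Lemma fmatE n (x : fmat) : ctrunc n (fmat_val x) = fmat_val x ->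
  x = mxsum funit n (fmat_val x).
Proof.
move=> nx; apply: fmatP.
rewrite /mxsum (big_morph fmat_val fmat_valD (erefl : fmat_val 0 = 0)).
under [RHS]eq_bigr => i _ do
  rewrite (big_morph fmat_val fmat_valD (erefl : fmat_val 0 = 0)).
by rewrite -{1}nx ctrunc_cunitE.
Qed.

Lemma funit_leavitt : @leavitt_family R[i] star_graph fmat
  (fun v => funit v v) (fun e => funit e.+1 0) (fun e => funit 0 e.+1).
Proof.
split=> [v|v w /negPf vw|e|e|e|e|e f|[|n]].
- by rewrite funitM eqxx.
- by rewrite funitM vw.
- by rewrite funitM eqxx.
- by rewrite funitM eqxx.
- by rewrite funitM eqxx.
- by rewrite funitM eqxx.
- by rewrite funitM eqSS.
- by case; rewrite emitted_star_centre => _ [].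
- by move=> _; rewrite emitted_star_leaf fsbig_set1 funitM.
Qed.

Lemma fmat_generated (S : set fmat) : subalgebra S ->
  (forall v : nat, S (funit v v)) -> (forall e : nat, S (funit e.+1 0)) ->
  (forall e : nat, S (funit 0 e.+1)) -> S = setT.
Proof.
move=> [S0 SD SZ SM] Sv Se St.
have Su i j : S (funit i j).
  have <- : funit i 0 ⋅ funit 0 j = funit i j by rewrite funitM.
  by apply: SM; [case: i|case: j].
apply/seteqP; split=> // x _; have /finite_matrixP[n nx] := fmat_finite x.
rewrite (fmatE nx); apply: (big_ind S) => // i _.
by apply: (big_ind S) => // j _; exact: SZ.
Qed.

Lemma fmat_universal (B : nonUnitalAlgType R[i]) (p : vertex star_graph -> B)
    (s t : edge star_graph -> B) : leavitt_family p s t ->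
  exists f : fmat -> B, [/\ algebra_hom f, forall v, f (funit v v) = p v,
    forall e, f (funit e.+1 0) = s e & forall e, f (funit 0 e.+1) = t e].
Proof.
move=> lf; pose u := matrix_unit p s t.
(* A corner is chosen for each matrix; [fE] below allows any other, in particular one common to two
   arguments. *)
have /choice[n nP] (x : fmat) : exists n, ctrunc n (fmat_val x) = fmat_val x.
  exact/finite_matrixP/fmat_finite.
pose f x := mxsum u (n x) (fmat_val x).
have fE m x : ctrunc m (fmat_val x) = fmat_val x -> f x = mxsum u m (fmat_val x).
  move=> mx; apply: mxsum_support.
    exact: (f_equal (@cmat_val R) (nP x)).
  exact: (f_equal (@cmat_val R) mx).
have fu i j : f (funit i j) = u i j.
  have [i_n j_n] : (i < (maxn i j).+1)%N /\ (j < (maxn i j).+1)%N.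
    by rewrite !ltnS leq_maxl leq_maxr.
  by rewrite (fE (maxn i j).+1) ?mxsum_delta // ctrunc_cunit.
exists f; split=> [|v|e|e]; rewrite ?fu.
- split=> [x y|k x|x y].
  + have [m [mx my]] := finite_matrix_common (fmat_finite x) (fmat_finite y).
    rewrite (fE m x mx) (fE m y my) -mxsumD; apply: (fE m).
    by rewrite fmat_valD ctruncD mx my.
  + rewrite (fE _ x (nP x)) -mxsumZ; apply: (fE (n x)).
    by rewrite fmat_valZ ctruncZ nP.
  + have [m [mx my]] := finite_matrix_common (fmat_finite x) (fmat_finite y).
    rewrite (fE m x mx) (fE m y my) -(mxsumM (matrix_unitM lf)) -cmuln_val.
    rewrite -(cmul_support mx my); apply: (fE m).
    by rewrite fmul_val (cmul_support mx my) ctrunc_cmuln.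
- exact: matrix_unit_vertex lf v.
- exact: matrix_unit_edge lf e.
- exact: matrix_unit_ghost lf e.
Qed.

Definition star_lpa : leavitt_path_algebra R[i] star_graph :=
  LeavittPathAlgebra funit_leavitt fmat_generated fmat_universal.

End StarGraphAlgebras.

(** * A compact matrix in the socle with infinite support *)
Section Strictness.
Variable R : realType.

Definition geometric_col : nat -> nat -> R[i]^o :=
  fun i j => if j is 0 then 2^-1 ^+ i else 0.

Lemma geometric_tail m n :
  \sum_(i < n) (if (m <= i)%N then 2^-1 ^+ i else 0) <= 2 * 2^-1 ^+ m :> R[i].
Proof.
(* The exact value of the partial tail is what induction on n can prove. *)
suff : \sum_(i < n) (if (m <= i)%N then 2^-1 ^+ i else 0) =
    if (m <= n)%N then 2 * 2^-1 ^+ m - 2 * 2^-1 ^+ n else 0 :> R[i].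
  move=> ->; case: ifP => _; last by rewrite mulr_ge0 // exprn_ge0 // invr_ge0.
  by rewrite gerBl mulr_ge0 // exprn_ge0 // invr_ge0.
elim: n => [|n IH].
  by rewrite big_ord0 leqn0; case: eqP => // ->; rewrite subrr.
rewrite big_ord_recr /= IH exprS mulVKf ?pnatr_eq0 //.
case: ltngtP => [mn|mn|->].
- by rewrite (leq_trans (ltnW mn)) //; ring.
- rewrite addr0; case: (ltngtP m n.+1) => [|//|->].
    by rewrite ltnS leqNgt mn.
  by rewrite exprS mulVKf ?pnatr_eq0 // subrr.
- by rewrite leqnSn; ring.
Qed.

(** What truncation removes is the tail of one column, so [mbound_sum] reduces the norm estimate to
    a geometric tail of size at most 2 / 2^n. The rank N satisfies 2 / r < N <= n < 2^n. *)
Lemma mcompact_geometric_col : mcompact geometric_col.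
Proof.
move=> e /complex_gt0P[r r0 ->]; pose N := Num.bound (2 / r); exists N => n Nn.
have rN : 2 * 2^-1 ^+ n <= r%:C.
  have -> : 2 * 2^-1 ^+ n = (2 * 2^-1 ^+ n : R)%:C.
    by rewrite rmorphM rmorphXn fmorphV rmorph_nat.
  rewrite lecR exprVn ler_pdivrMr ?exprn_gt0 // -ler_pdivrMl // mulrC.
  have r20 : 0 <= 2 / r by rewrite divr_ge0 // ltW.
  rewrite (le_trans (ltW (archi_boundP r20))) // -natrX ler_nat.
  by rewrite (leq_trans Nn) // ltnW // ltn_expl.
apply: mbound_le rN _; apply: mbound_sum => k; apply: le_trans (geometric_tail n k).
apply: ler_sum => i _.
have entryE l j : (geometric_col - mtrunc n geometric_col) l j =
    geometric_col l j - mtrunc n geometric_col l j by [].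
case: k i => [[]//|k] i; rewrite big_ord_recl big1 => [|j _]; last first.
  by rewrite entryE /mtrunc /= if_same subrr normr0.
rewrite addr0 entryE /mtrunc /=; case: ltnP => [i_n|ni] /=.
  by rewrite (leq_ltn_trans _ i_n) // subrr normr0.
by rewrite subr0 ger0_norm // exprn_ge0 // invr_ge0.
Qed.

Definition geometric_cmat : cmat R :=
  CMat (introT (compact_matrixP _) mcompact_geometric_col).

Lemma geometric_cmatM : geometric_cmat ⋅ cunit R 0 0 = geometric_cmat.
Proof.
have ge : cmuln n geometric_cmat (cunit R 0 0) @[n --> \oo] -->
    geometric_cmat ⋅ cunit R 0 0 by exact: cmul_cvg.
apply: (norm_cvg_unique ge).
apply: cvg_dist0 => e e0; have [m mP] := ctrunc_near geometric_cmat e0.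
exists m.+1 => n mn; suff -> : cmuln n geometric_cmat (cunit R 0 0) =
  ctrunc n geometric_cmat by apply: mP; exact: ltnW.
apply: cmatP; rewrite cmuln_val; apply/funext => i; apply/funext => j.
rewrite mmulE -[RHS]/(mtrunc n geometric_col i j) /mtrunc.
case: ifP => // /andP[i_n j_n].
have n0 : (0 < n)%N by exact: leq_ltn_trans j_n.
rewrite (bigD1 (Ordinal n0)) //= big1 ?addr0 => [|k /negPf].
  rewrite /delta_matrix eqxx /=.
  by case: j {j_n} => [|j]; rewrite ?mulr1 // mulr0.
by rewrite -val_eqE /= => k0; rewrite /delta_matrix k0 mulr0.
Qed.

(** For a truncation only the term of index (0,0) survives the compression; continuity of the
    product gives the general case. *)
Lemma cunit_corner (x : cmat R) :
  cunit R 0 0 ⋅ x ⋅ cunit R 0 0 = x 0 0 *: cunit R 0 0.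
Proof.
pose e := cunit R 0 0.
have ex : e ⋅ ctrunc n x ⋅ e @[n --> \oo] --> e ⋅ x ⋅ e.
  apply: cmul_cvg2; last exact: cvg_cst.
  by apply: cmul_cvg2; [exact: cvg_cst|exact: ctrunc_cvg].
apply: (norm_cvg_unique ex); apply: cvg_dist0 => d d0.
exists 1%N => n n1; suff -> : e ⋅ ctrunc n x ⋅ e = x 0 0 *: e.
  by rewrite subrr normr0 ltW.
rewrite ctrunc_cunitE /mxsum amul_sumr amul_suml (bigD1 (Ordinal n1)) //=.
rewrite [X in _ + X]big1 ?addr0 => [|i /negPf].
  rewrite amul_sumr amul_suml (bigD1 (Ordinal n1)) //= big1 ?addr0 => [|j /negPf].
    by rewrite amulZr amulZl !cunitM.
  by rewrite -val_eqE /= => j0; rewrite amulZr amulZl !cunitM j0 scaler0.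
rewrite -val_eqE /= => i0; rewrite amul_sumr amul_suml big1 // => j _.
by rewrite amulZr cunitM eq_sym i0 scaler0 amul0l.
Qed.

Lemma geometric_cmat_socle : socle (cmat R) geometric_cmat.
Proof.
have ee : cunit R 0 0 ⋅ cunit R 0 0 = cunit R 0 0 by rewrite cunitM.
apply: (@minimal_left_ideal_socle _ _ [set a ⋅ cunit R 0 0 | a in setT]).
  apply: minimal_idempotent_left_ideal ee _ _.
    move=> /(congr1 (fun x => cmat_val x 0 0)) e10.
    by have : (1 : R[i]) == 0; [exact/eqP|rewrite oner_eq0].
  by move=> x; exists (x 0 0); exact: cunit_corner.
by exists geometric_cmat => //; exact: geometric_cmatM.
Qed.

Lemma geometric_cmat_infinite : geometric_cmat \notin @finite_matrix R.
Proof.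
apply/negP => /finite_matrixP[n /(congr1 (fun x => cmat_val x n 0))].
rewrite /= /mtrunc ltnn /= => /esym/eqP.
by rewrite expf_eq0 invr_eq0 pnatr_eq0 andbF.
Qed.

End Strictness.

Theorem proposition3p6 (R : realType) :
  (forall (E : graph) (L : leavitt_path_algebra R[i] E)
      (A : graph_cstar_algebra R E) (phi : L -> A),
    canonical_embedding phi -> phi @` socle L `<=` socle A) /\
  (exists (E : graph) (L : leavitt_path_algebra R[i] E)
      (A : graph_cstar_algebra R E) (phi : L -> A),
    [/\ row_finite E, canonical_embedding phi
      & phi @` socle L `<` socle A]).
Proof.
split=> [E L A phi|]; first exact: canonical_embedding_socle.
pose phi (x : star_lpa R) : star_gca R := fmat_val x.
have cphi : canonical_embedding phi.
  by split=> // e; rewrite /phi /= cunit_star.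
exists star_graph, (star_lpa R), (star_gca R), phi; split=> //.
  exact: star_graph_row_finite.
split; first exact: canonical_embedding_socle.
move=> /(_ _ (geometric_cmat_socle R))[x _ xE].
by have := geometric_cmat_infinite R; rewrite -xE (fmat_finite x).
Qed.
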